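(* Let $F$ be Thompson's group with standard generators $\mathsf{x}_0,\mathsf{x}_1$, let $$H_{<1}=\{ f\in F \mid 1\notin\overline{\mathsf{supp}}(f)\},$$ and let $F*_{H_{<1}}=\langle F, g \mid ghg^{-1}=h,\ h\in H_{<1}\rangle$ be the centralized HNN-extension of $F$ over $H_{<1}$. Then there is a sequence $(g_n)_{n\in\mathbb{N}}$ of elements of $F$ such that the sequence of marked groups $G_n=(F,(g_n,\mathsf{x}_0,\mathsf{x}_1))$ is convergent and $$\lim_{n\to\infty}G_n=(F*_{H_{<1}},(g,\mathsf{x}_0,\mathsf{x}_1)).$$
   Context: Thompson's group $F$ is the group (under composition) of all increasing piecewise-linear homeomorphisms of $[0,1]$ that are differentiable except at finitely many dyadic rationals and whose slopes are integer powers of $2$. It is generated by $\mathsf{x}_0,\mathsf{x}_1$, where $\mathsf{x}_0(t)=\frac12 t$ on $[0,\frac12]$, $t-\frac14$ on $[\frac12,\frac34]$, $2t-1$ on $[\frac34,1]$; and $\mathsf{x}_1(t)=t$ on $[0,\frac12]$, $\frac12 t+\frac14$ on $[\frac12,\frac34]$, $t-\frac18$ on $[\frac34,\frac78]$, $2t-1$ on $[\frac78,1]$. For $f\in F$, $\mathsf{supp}(f)=\{x\in[0,1] : f(x)\neq x\}$ and $\overline{\mathsf{supp}}(f)$ is its topological closure. Marked groups: a marked group $(G,(s_1,\dots,s_m))$ is a group with an ordered tuple of generators, considered up to isomorphism of marked groups. On the set $\mathcal{G}_m$ of groups marked by $m$ generators, two marked groups are at distance at most $e^{-r}$ if they have exactly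 the same relations of length at most $r$. Thus $(G_n,S_n)\to(G,S)$ iff for every word $w$ of the free group on $m$ letters: if $w(S)=1$ in $G$ then $w(S_n)=1$ in $G_n$ for all sufficiently large $n$, and if $w(S)\ne1$ in $G$ then $w(S_n)\neq1$ in $G_n$ for all sufficiently large $n$. *)

(* Defs.v *)
From HB Require Import structures.
From mathcomp Require Import all_boot all_order all_algebra.
From mathcomp Require Import all_classical all_reals all_analysis.
From mathcomp Require Import generic_quotient ring lra.

Set Implicit Arguments.
Unset Strict Implicit.
Unset Printing Implicit Defensive.

Import Order.TTheory GRing.Theory Num.Theory.
Import numFieldNormedType.Exports.

Local Open Scope classical_set_scope.
Local Open Scope quotient_scope.
Local Open Scope ring_scope.


(* [(x, true)] stands for the letter [x] and [(x, false)] for its inverse;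
   words need not be reduced. *)
Definition word (X : Type) := seq (X * bool).

Definition winv (X : Type) (w : word X) : word X :=
  rev [seq (l.1, ~~ l.2) | l <- w].

Definition weval (X : Type) (G : groupType) (s : X -> G) (w : word X) : G :=
  (\prod_(l <- w) (if l.2 then s l.1 else (s l.1)^-1))%g.

Definition generates (G : groupType) (m : nat) (s : m.-tuple G) : Prop :=
  forall x : G, exists w : word 'I_m, weval (tnth s) w = x.

Record markedGroup (m : nat) := MarkedGroup {
  mgroup : groupType;
  mgens : m.-tuple mgroup;
  mgensP : generates mgens }.

Definition is_relation (m : nat) (G : markedGroup m) (w : word 'I_m) : Prop :=
  weval (tnth (mgens G)) w = 1%g.

Definition same_relations (m r : nat) (G H : markedGroup m) : Prop :=
  forall w : word 'I_m, (size w <= r)%N -> (is_relation G w <-> is_relation H w).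

(* This depends only on the isomorphism classes of [G] and [H] as marked
   groups, so there is no need to pass to the quotient. *)
Definition marked_dist (R : realType) (m : nat) (G H : markedGroup m) : R :=
  inf [set expR (- r%:R) | r in [set r : nat | same_relations r G H]].


Section Presentation.
Variables (X : choiceType) (P : set (word X)).

Inductive pres_eq : word X -> word X -> Prop :=
| pres_refl u : pres_eq u u
| pres_sym u v : pres_eq u v -> pres_eq v u
| pres_trans u v w : pres_eq u v -> pres_eq v w -> pres_eq u w
| pres_cat u u' v v' :
    pres_eq u u' -> pres_eq v v' -> pres_eq (u ++ v) (u' ++ v')
| pres_cancel x b : pres_eq [:: (x, b); (x, ~~ b)] [::]
| pres_relator r : P r -> pres_eq r [::].

Definition pres_eqb : rel (word X) := fun u v => `[< pres_eq u v >].

Lemma pres_eqb_refl : reflexive pres_eqb.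
Proof. by move=> u; apply/asboolP; exact: pres_refl. Qed.

Lemma pres_eqb_sym : symmetric pres_eqb.
Proof. by move=> u v; apply/asboolP/asboolP; exact: pres_sym. Qed.

Lemma pres_eqb_trans : transitive pres_eqb.
Proof.
move=> v u w /asboolP uv /asboolP vw; apply/asboolP; exact: pres_trans vw.
Qed.

Canonical pres_equiv :=
  EquivRel pres_eqb pres_eqb_refl pres_eqb_sym pres_eqb_trans.

Definition presented := {eq_quot pres_equiv}.
HB.instance Definition _ := Choice.on presented.

Definition pclass (w : word X) : presented := \pi_({eq_quot pres_equiv}) w.

Lemma pclassP u v : pclass u = pclass v <-> pres_eq u v.
Proof.
split=> [/eqP|uv]; first by rewrite /pclass eqmodE => /asboolP.
by apply/eqP; rewrite /pclass eqmodE; apply/asboolP.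
Qed.

Lemma pclass_repr (a : presented) : pclass (repr a) = a.
Proof. exact: reprK. Qed.

Lemma pres_repr u : pres_eq (repr (pclass u)) u.
Proof. by apply/pclassP; rewrite pclass_repr. Qed.

Lemma pres_winv u v : pres_eq u v -> pres_eq (winv u) (winv v).
Proof.
have catV w w' : winv (w ++ w') = winv w' ++ winv w by rewrite /winv map_cat rev_cat.
have Vr w : pres_eq (winv w ++ w) [::].
  elim: w => [|[x b] w IH]; first exact: pres_refl.
  rewrite -[_ :: w]cat1s catV -catA [X in _ ++ X]catA.
  apply: pres_trans IH; apply: pres_cat; first exact: pres_refl.
  rewrite -[w in X in pres_eq _ X]cat0s; apply: pres_cat; last exact: pres_refl.
  by have := pres_cancel x (~~ b); rewrite negbK.
have rV w : pres_eq (w ++ winv w) [::].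
  elim: w => [|[x b] w IH]; first exact: pres_refl.
  rewrite -[_ :: w]cat1s catV -catA [X in _ ++ X]catA.
  apply: (@pres_trans _ ([:: (x, b)] ++ ([::] ++ winv [:: (x, b)]))).
    by apply: pres_cat (pres_refl _) (pres_cat IH (pres_refl _)).
  exact: pres_cancel.
move=> uv; apply: (@pres_trans _ (winv u ++ (v ++ winv v))).
  rewrite -[X in pres_eq X]cats0.
  by apply: pres_cat (pres_refl _) (pres_sym (rV _)).
rewrite catA -[X in pres_eq _ X]cat0s; apply: pres_cat (pres_refl _).
apply: pres_trans (Vr u); apply: pres_cat (pres_refl _) (pres_sym uv).
Qed.

Definition pone : presented := pclass [::].
Definition pmul (a b : presented) := pclass (repr a ++ repr b).
Definition pinv (a : presented) := pclass (winv (repr a)).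

Lemma pmulE u v : pmul (pclass u) (pclass v) = pclass (u ++ v).
Proof. by apply/pclassP; apply: pres_cat; exact: pres_repr. Qed.

Lemma pinvE u : pinv (pclass u) = pclass (winv u).
Proof. by apply/pclassP; apply: pres_winv; exact: pres_repr. Qed.

Lemma pmulA : associative pmul.
Proof.
move=> a b c; rewrite -(pclass_repr a) -(pclass_repr b) -(pclass_repr c).
by rewrite !pmulE catA.
Qed.

Lemma pmul1 : left_id pone pmul.
Proof. by move=> a; rewrite -(pclass_repr a) pmulE. Qed.

Lemma pmulr1 : right_id pone pmul.
Proof. by move=> a; rewrite -(pclass_repr a) pmulE cats0. Qed.

Lemma pmulrV : right_inverse pone pinv pmul.
Proof.
move=> a; rewrite -(pclass_repr a) pinvE pmulE; apply/pclassP.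
elim: (repr a) => [|[x b] w IH]; first exact: pres_refl.
rewrite /winv map_cons rev_cons -cats1 catA.
apply: (@pres_trans _ ([:: (x, b)] ++ ([::] ++ [:: (x, ~~ b)]))).
  rewrite -cat1s -!catA.
  apply: pres_cat (pres_refl _) _; rewrite catA.
  exact: pres_cat IH (pres_refl _).
exact: pres_cancel.
Qed.

Lemma pmulVr : left_inverse pone pinv pmul.
Proof.
move=> a; rewrite -[a in X in pmul _ X](_ : pinv (pinv a) = a) ?pmulrV//.
rewrite -(pclass_repr a) !pinvE; congr pclass.
rewrite /winv map_rev revK -map_comp -[RHS]map_id.
by apply: eq_map => -[x b] /=; rewrite negbK.
Qed.

HB.instance Definition _ :=
  isGroup.Build presented pmulA pmul1 pmulr1 pmulVr pmulrV.

Definition pgen (x : X) : presented := pclass [:: (x, true)].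

End Presentation.


Section HNN.
Variables (G : groupType) (H : set G).

(* The generators are [Some a] for [a : G], subject to the multiplication
   table of [G], and the stable letter [None]. *)
Definition hnn_relators : set (word (option G)) :=
  [set [:: (Some p.1, true); (Some p.2, true); (Some (p.1 * p.2)%g, false)]
     | p in [set: G * G]] `|`
  [set [:: (None, true); (Some h, true); (None, false); (Some h, false)]
     | h in H].

Definition centralized_hnn := presented hnn_relators.
HB.instance Definition _ := Group.on centralized_hnn.

Definition hnn_base (a : G) : centralized_hnn := pgen hnn_relators (Some a).
Definition hnn_stable : centralized_hnn := pgen hnn_relators None.

End HNN.


Section Thompson.
Variable R : realType.
Implicit Types (f g : R -> R) (s : seq R).

Definition dyadic (x : R) : Prop :=
  exists (a : int) (n : nat), x = a%:~R / 2 ^+ n.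

Definition piece s (a b : R) : Prop :=
  [/\ 0 <= a, a < b, b <= 1 & {in s, forall c, ~~ (a < c < b)}].

(* A self-homeomorphism of [0,1] is encoded by its extension to [R] by the
   identity outside [0,1], so that equality of group elements is equality of
   functions. *)
Record is_thompson f : Prop := IsThompson {
  thompson_out : forall x : R, x \notin `[0, 1] -> f x = x;
  thompson_homeo : exists g,
    [/\ {within `[0, 1], continuous f} /\ {within `[0, 1], continuous g},
        set_fun `[0, 1] `[0, 1] f, set_fun `[0, 1] `[0, 1] g,
        {in `[0, 1], cancel f g} & {in `[0, 1], cancel g f}];
  thompson_incr : {in `[0, 1] &, {homo f : x y / x < y}};
  thompson_affine : exists s, forall a b, piece s a b ->
    exists m q, {in `[a, b], forall x, f x = m * x + q};
  thompson_diff : exists2 s : seq R, {in s, forall c, dyadic c} &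
    forall x : R, 0 < x < 1 -> x \notin s -> derivable f x 1;
  thompson_slope : forall x : R, 0 < x < 1 -> derivable f x 1 ->
    exists k : int, 'D_1 f x = 2 ^ k }.

(* An equivalent, more convenient form of the last three conditions. *)
Definition dyadic_affine s f : Prop := {in s, forall c, dyadic c} /\
  forall a b, piece s a b ->
    exists k : int, {in `[a, b], forall x, f x = f a + 2 ^ k * (x - a)}.

Lemma piece_ind s (Q : R -> R -> Prop) :
  (forall a b, piece s a b -> Q a b) ->
  (forall a c b, 0 <= a -> a < c -> c < b -> b <= 1 -> c \in s ->
     Q a c -> Q c b -> Q a b) ->
  forall a b, 0 <= a -> a < b -> b <= 1 -> Q a b.
Proof.
move=> HP HQ a b a0 ab b1.
have {HP} HP u v : piece s u v -> a <= u -> v <= b -> Q u v by move=> /HP.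
have {HQ} : forall a c b, 0 <= a -> a < c -> c < b -> b <= 1 -> c \in s ->
     Q a c -> Q c b -> Q a b by [].
elim: s a b a0 ab b1 HP => [|c s IH] a b a0 ab b1 HP HQ.
  by apply: HP.
have HQ' u d v : 0 <= u -> u < d -> d < v -> v <= 1 -> d \in s ->
    Q u d -> Q d v -> Q u v.
  by move=> u0 ud dv v1 ds; apply: HQ => //; rewrite inE ds orbT.
have [/andP[ac cb]|cab] := boolP (a < c < b).
  apply: (HQ a c b) => //; rewrite ?mem_head//.
    apply: IH => //; first lra.
    move=> u v [u0 uv v1 uvs] au vc; apply: HP => //; last lra.
    split=> // d; rewrite inE => /orP[/eqP->|/uvs//]; lra.
  apply: IH => //; first lra.
  move=> u v [u0 uv v1 uvs] au vc; apply: HP => //; last lra.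
  split=> // d; rewrite inE => /orP[/eqP->|/uvs//]; lra.
apply: IH => // u v [u0 uv v1 uvs] au vb; apply: HP => //.
split=> // d; rewrite inE => /orP[/eqP->|/uvs//]; lra.
Qed.

Lemma pow2_gt0 (k : int) : 0 < 2 ^ k :> R.
Proof. by rewrite exprz_gt0. Qed.

Lemma dyadicD x y : dyadic x -> dyadic y -> dyadic (x + y).
Proof.
move=> [a [m ->]] [b [n ->]]; exists (a * 2 ^+ n + b * 2 ^+ m), (m + n)%N.
have h i : 2 ^+ i != 0 :> R by rewrite expf_neq0// pnatr_eq0.
rewrite intrD !intrM !rmorphXn/= exprD; field.
by rewrite !h.
Qed.

Lemma dyadicN x : dyadic x -> dyadic (- x).
Proof. by move=> [a [m ->]]; exists (- a), m; rewrite intrN mulNr. Qed.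

Lemma dyadicZ (k : int) x : dyadic x -> dyadic (2 ^ k * x).
Proof.
move=> [a [m ->]].
have h i : 2 ^+ i != 0 :> R by rewrite expf_neq0// pnatr_eq0.
case: k => k.
  exists (2 ^+ k * a), m; rewrite intrM !rmorphXn/= mulrA.
  by [].
exists a, (k.+1 + m)%N; rewrite NegzE -exprnN exprD; field.
by rewrite !h.
Qed.

Lemma right_slope f (x L e : R) : 0 < e ->
  (forall h, 0 < h < e -> f (x + h) = f x + L * h) ->
  derivable f x 1 -> 'D_1 f x = L.
Proof.
move=> e0 fE df.
have /cvg_dnbhs_at_right c1 : h^-1 *: (f (h *: (1 : R) + x) - f x) @[h --> 0^'] --> 'D_1 f x.
  exact: df.
have c2 : h^-1 *: (f (h *: (1 : R) + x) - f x) @[h --> 0^'+] --> L.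
  apply: cvg_near_cst; near=> h.
  have h0 : 0 < h by [].
  have he : h < e by near: h; exact: nbhs_right_lt.
  rewrite [h *: 1]mulr1 [h + x]addrC fE ?h0//.
  rewrite /GRing.scale/=; field; lra.
exact: (cvg_unique _ c1 c2).
Unshelve. all: by end_near.
Qed.

Lemma left_slope f (x L e : R) : 0 < e ->
  (forall h, 0 < h < e -> f (x - h) = f x - L * h) ->
  derivable f x 1 -> 'D_1 f x = L.
Proof.
move=> e0 fE df.
have /cvg_dnbhs_at_left c1 : h^-1 *: (f (h *: (1 : R) + x) - f x) @[h --> 0^'] --> 'D_1 f x.
  exact: df.
have c2 : h^-1 *: (f (h *: (1 : R) + x) - f x) @[h --> 0^'-] --> L.
  apply: cvg_near_cst; near=> h.
  have h0 : h < 0 by [].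
  have he : - e < h by near: h; apply: nbhs_left_gt; rewrite oppr_lt0.
  rewrite [h *: 1]mulr1 [h + x]addrC -[h in x + h]opprK fE; last lra.
  rewrite /GRing.scale/=; field; lra.
exact: (cvg_unique _ c1 c2).
Unshelve. all: by end_near.
Qed.

Lemma right_piece s (x : R) : 0 <= x -> x < 1 -> exists b, piece s x b.
Proof.
move=> x0 x1; elim: s => [|c s [b [_ xb b1 bs]]].
  by exists 1; split.
have [/andP[xc cb]|xcb] := boolP (x < c < b).
  exists c; split=> //; first lra.
  move=> d; rewrite inE => /orP[/eqP->|/bs]; lra.
exists b; split=> // d; rewrite inE => /orP[/eqP->//|/bs//].
Qed.

Lemma left_piece s (x : R) : 0 < x -> x <= 1 -> exists a, piece s a x.
Proof.
move=> x0 x1; elim: s => [|c s [b [b0 xb b1 bs]]].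
  by exists 0; split.
have [/andP[xc cb]|xcb] := boolP (b < c < x).
  exists c; split=> //; first lra.
  move=> d; rewrite inE => /orP[/eqP->|/bs]; lra.
exists b; split=> // d; rewrite inE => /orP[/eqP->//|/bs//].
Qed.

Lemma thompson_dyadic_affine f :
  is_thompson f -> exists s, dyadic_affine s f.
Proof.
move=> [_ _ _ [s0 aff] [s ds df] slope]; exists s; split=> // a b [a0 ab b1 abs].
move: abs; move: a b a0 ab b1; apply: (@piece_ind s0).
  move=> a b pab abs; have [m [q fE]] := aff _ _ pab.
  have [a0 ab b1 _] := pab.
  pose z : R := (a + b) / 2.
  have zI : 0 < z < 1 by rewrite /z; lra.
  have dz : derivable f z 1.
    apply: df => //; apply/negP => /abs; rewrite /z; lra.
  have [k Dk] := slope z zI dz; exists k.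
  have mE : m = 2 ^ k.
    rewrite -Dk; apply/esym; apply: (@right_slope f z m ((b - a) / 2)) => //; first lra.
    move=> h hI; rewrite !fE ?in_itv/= /z; lra.
  move=> x; rewrite in_itv/= => xI; rewrite !fE ?in_itv/=; try lra.
  by rewrite -mE; ring.
move=> a c b a0 ac cb b1 _ Qac Qcb abs.
have [k fk] : exists k : int, {in `[a, c], forall x, f x = f a + 2 ^ k * (x - a)}.
  apply: Qac => d /abs; lra.
have [l fl] : exists k : int, {in `[c, b], forall x, f x = f c + 2 ^ k * (x - c)}.
  apply: Qcb => d /abs; lra.
have dc : derivable f c 1.
  by apply: df; [lra|apply/negP => /abs; lra].
have fcE : f c = f a + 2 ^ k * (c - a) by apply: fk; rewrite in_itv/=; lra.
have kl : 2 ^ k = 2 ^ l :> R.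
  transitivity ('D_1 f c).
    apply/esym; apply: (@left_slope f c _ (c - a)) => //; first lra.
    move=> h hI; rewrite fk ?in_itv/=; last lra.
    by rewrite fcE; ring.
  apply: (@right_slope f c _ (b - c)) => //; first lra.
  move=> h hI; rewrite fl ?in_itv/=; last lra.
  by ring.
exists k => x; rewrite in_itv/= => xI.
have [xc|cx] := leP x c; first by rewrite fk// in_itv/=; lra.
rewrite fl ?in_itv/=; last lra.
by rewrite fcE kl; ring.
Qed.

Lemma thompson0 f : is_thompson f -> f 0 = 0.
Proof.
move=> [_ [g [_ fI gI _ gK]] fS _ _ _].
have I0 : (0 : R) \in `[0, 1] by rewrite in_itv/= lexx ler01.
have := fI _ I0; have := gI _ I0; rewrite /= !in_itv/= => /andP[g0 g1] /andP[f0 _].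
apply/eqP; rewrite eq_le f0 andbT.
move: g0; rewrite le_eqVlt => /orP[/eqP g0|g0]; first by rewrite {1}g0 gK.
by rewrite -[leRHS]gK// ltW// fS// in_itv/= g1 ltW.
Qed.

Lemma thompson1 f : is_thompson f -> f 1 = 1.
Proof.
move=> [_ [g [_ fI gI _ gK]] fS _ _ _].
have I1 : (1 : R) \in `[0, 1] by rewrite in_itv/= lexx ler01.
have := fI _ I1; have := gI _ I1; rewrite /= !in_itv/= => /andP[g0 g1] /andP[_ f1].
apply/eqP; rewrite eq_le f1/=.
move: g1; rewrite le_eqVlt => /orP[/eqP g1|g1]; first by rewrite -{2}g1 gK.
by rewrite -[leLHS]gK// ltW// fS// in_itv/= g0 ltW.
Qed.

Lemma affine_incr s f : dyadic_affine s f ->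
  {in `[0, 1] &, {homo f : x y / x < y}}.
Proof.
move=> [_ aff]; have /(_ 0 1) : forall a b, 0 <= a -> a < b -> b <= 1 ->
    {in `[a, b] &, {homo f : x y / x < y}}.
  apply: (@piece_ind s).
    move=> a b pab; have [k fk] := aff _ _ pab => x y xI yI xy.
    by rewrite (fk _ xI) (fk _ yI) ltrD2l ltr_pM2l ?pow2_gt0// ltrD2r.
  move=> a c b a0 ac cb b1 _ Qa Qb x y; rewrite !in_itv/= => xI yI xy.
  have [xc|cx] := leP x c; last by apply: Qb => //; rewrite in_itv/=; lra.
  have [yc|cy] := leP y c; first by apply: Qa => //; rewrite in_itv/=; lra.
  have fcy : f c < f y by apply: Qb => //; rewrite in_itv/=; lra.
  move: xc; rewrite le_eqVlt => /orP[/eqP->//|xc].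
  apply: lt_trans fcy; apply: Qa => //; rewrite in_itv/=; lra.
by apply.
Qed.

Lemma affine_surj s f : dyadic_affine s f -> forall y, f 0 <= y <= f 1 ->
  exists2 x, 0 <= x <= 1 & f x = y.
Proof.
move=> [_ aff]; have /(_ 0 1) : forall a b, 0 <= a -> a < b -> b <= 1 ->
    forall y, f a <= y <= f b -> exists2 x, a <= x <= b & f x = y.
  apply: (@piece_ind s).
    move=> a b pab; have [k fk] := aff _ _ pab => y /andP[ay yb].
    have [_ ab _ _] := pab; have k0 := pow2_gt0 k.
    have fbE : f b = f a + 2 ^ k * (b - a) by apply: fk; rewrite in_itv/=; lra.
    have xI : a <= a + (y - f a) / 2 ^ k <= b.
      have X0 : 0 <= (y - f a) / 2 ^ k by rewrite divr_ge0 ?subr_ge0// ltW.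
      have Xb : (y - f a) / 2 ^ k <= b - a by rewrite ler_pdivrMr// mulrC; lra.
      by apply/andP; split; lra.
    exists (a + (y - f a) / 2 ^ k) => //.
    by rewrite fk ?in_itv//=; field; rewrite lt0r_neq0.
  move=> a c b a0 ac cb b1 _ Qa Qb y yI.
  have [yc|cy] := leP y (f c).
    have [|x xI <-] := Qa y; first lra.
    by exists x => //; lra.
  have [|x xI <-] := Qb y; first lra.
  by exists x => //; lra.
by apply.
Qed.

Lemma incr_surj_continuous g : g 0 = 0 -> g 1 = 1 ->
  {in `[0, 1] &, {homo g : x y / x < y}} ->
  (forall y, 0 <= y <= 1 -> exists2 x, 0 <= x <= 1 & g x = y) ->
  {within `[0, 1], continuous g}.
Proof.
move=> g0 g1 gS gsurj; apply: segment_inc_surj_continuous.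
  exact: le_mono_in.
rewrite g0 g1 => y /=; rewrite in_itv/= => /gsurj[x xI <-].
by exists x.
Qed.

Lemma affine_is_thompson s f :
  (forall x : R, x \notin `[0, 1] -> f x = x) -> f 0 = 0 -> f 1 = 1 ->
  dyadic_affine s f -> is_thompson f.
Proof.
move=> fout f0 f1 aff; have fS := affine_incr aff.
have fsurj := affine_surj aff; rewrite f0 f1 in fsurj.
have I0 : (0 : R) \in `[0, 1] by rewrite in_itv/= lexx ler01.
have I1 : (1 : R) \in `[0, 1] by rewrite in_itv/= lexx ler01.
have fmono := le_mono_in fS.
have fI : set_fun `[0, 1] `[0, 1] f.
  move=> x /= xI; rewrite in_itv/= -{1}f0 -f1 !fmono//.
split=> //.
- have /choice[g gP] : forall y, exists x, 0 <= y <= 1 -> 0 <= x <= 1 /\ f x = y.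
    move=> y; have [/fsurj[x xI xy]|_] := boolP (0 <= y <= 1); first by exists x.
    by exists 0.
  have gI : set_fun `[0, 1] `[0, 1] g.
    by move=> y /=; rewrite !in_itv/= => /gP[].
  have gK : {in `[0, 1], cancel g f}.
    by move=> y /=; rewrite !in_itv/= => /gP[].
  have fK : {in `[0, 1], cancel f g}.
    move=> x xI; apply: (inc_inj_in fmono) => //; first exact/gI/fI.
    by rewrite gK//; exact: fI.
  exists g; split=> //; split; first exact: incr_surj_continuous.
  apply: incr_surj_continuous.
  + by rewrite -[in LHS]f0 fK.
  + by rewrite -[in LHS]f1 fK.
  + move=> x y xI yI xy; rewrite -(leW_mono_in fmono) ?gK//; exact: gI.
  + move=> y yI; exists (f y); first by have /= := fI y; rewrite !in_itv/=; apply.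
    by rewrite fK.
- exists s => a b /aff.2[k fk]; exists (2 ^ k), (f a - 2 ^ k * a) => x /fk ->.
  by ring.
- exists s; first exact: aff.1.
  move=> x /andP[x0 x1] xs.
  have [a [a0 ax _ pa]] := left_piece s x0 (ltW x1).
  have [b [_ xb b1 pb]] := right_piece s (ltW x0) x1.
  have [|k fk] := aff.2 a b.
    split=> //; first lra.
    move=> c cs; have := pa _ cs; have := pb _ cs.
    have : c != x by apply: contraNneq xs => <-.
    by case: (ltgtP c x); lra.
  apply: (@near_eq_derivable _ _ _ (fun y => f a + 2 ^ k * (y - a))).
    near=> y; rewrite (fk y)// in_itv/=; apply/andP; split; apply: ltW.
      by near: y; exact: lt_nbhsr.
    by near: y; exact: lt_nbhsl.
  by apply/derivable1_diffP.
- move=> x /andP[x0 x1] dfx.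
  have [b pb] := right_piece s (ltW x0) x1.
  have [k fk] := aff.2 _ _ pb; have [_ xb _ _] := pb.
  exists k; apply: (@right_slope f x _ (b - x)) => //; first lra.
  move=> h hI; rewrite fk ?in_itv/=; last lra.
  by ring.
Unshelve. all: by end_near.
Qed.

Lemma thompson_le f : is_thompson f -> {mono f : x y / x <= y}.
Proof.
move=> fT; apply: le_mono => x y xy.
have [f0 f1] := (thompson0 fT, thompson1 fT).
case: fT => fout [g [_ fI _ _ _]] fS _ _ _.
have [xI|xI] := boolP (x \in `[0, 1]); have [yI|yI] := boolP (y \in `[0, 1]).
- exact: fS.
- have := fI _ xI; rewrite (fout _ yI) /=; move: xI yI; rewrite !in_itv/=; lra.
- have := fI _ yI; rewrite (fout _ xI) /=; move: xI yI; rewrite !in_itv/=; lra.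
- by rewrite !fout.
Qed.

Lemma thompson_itv f : is_thompson f ->
  forall x, (f x \in `[0, 1]) = (x \in `[0, 1]).
Proof.
move=> fT x; rewrite !in_itv/= -[in LHS](thompson0 fT) -[in LHS](thompson1 fT).
by rewrite !(thompson_le fT).
Qed.

Lemma thompson_dyadic f : is_thompson f -> forall x, dyadic (f x) <-> dyadic x.
Proof.
move=> fT; have [s [ds aff]] := thompson_dyadic_affine fT.
have d0 : dyadic 0 by exists 0, 0%N; rewrite mul0r.
move=> x; have [|xI] := boolP (x \in `[0, 1]); last by rewrite thompson_out.
rewrite in_itv/=; move: x.
have /(_ 0 1) : forall a b, 0 <= a -> a < b -> b <= 1 -> dyadic a ->
    dyadic (f a) -> forall x, a <= x <= b -> dyadic (f x) <-> dyadic x.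
  apply: (@piece_ind s).
    move=> a b pab da dfa x xI; have [k fk] := aff _ _ pab.
    have fxE : f x = f a + 2 ^ k * (x - a) by rewrite fk// in_itv.
    split=> [dfx|dx]; last first.
      by rewrite fxE; apply: dyadicD => //; apply/dyadicZ/dyadicD => //; exact: dyadicN.
    have -> : x = a + 2 ^ (- k) * (f x - f a).
      rewrite fxE addrAC subrr add0r mulrA -expfzDr ?pnatr_eq0// addNr expr0z.
      by ring.
    by apply: dyadicD => //; apply/dyadicZ/dyadicD => //; exact: dyadicN.
  move=> a c b a0 ac cb b1 cs Qa Qb da dfa x xI.
  have [xc|cx] := leP x c; first by apply: Qa => //; lra.
  have dc := ds _ cs.
  have dfc : dyadic (f c) by apply/Qa => //; lra.
  by apply: Qb => //; lra.
by apply=> //; rewrite thompson0.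
Qed.

Lemma id_is_thompson : is_thompson (fun x => x).
Proof.
apply: (@affine_is_thompson [::]) => //; split=> // a b _; exists 0 => x _.
by rewrite expr0z; ring.
Qed.

Lemma inv_is_thompson f g : is_thompson f -> cancel g f -> is_thompson g.
Proof.
move=> fT gK; have fmono := thompson_le fT; have fltm := leW_mono fmono.
have finj := inc_inj fmono.
have fK : cancel f g by move=> x; apply: finj; rewrite gK.
have [s [ds aff]] := thompson_dyadic_affine fT.
apply: (@affine_is_thompson (map f s)).
- by move=> x xI; apply: finj; rewrite gK thompson_out.
- by rewrite -[in LHS](thompson0 fT) fK.
- by rewrite -[in LHS](thompson1 fT) fK.
split=> [c /mapP[d /ds dd ->]|a b [a0 ab b1 pab]].
  exact/(thompson_dyadic fT).
have gab : g a < g b by rewrite -fltm !gK.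
have [|k fk] := aff (g a) (g b).
  split=> //.
  - by rewrite -fmono thompson0// gK.
  - by rewrite -fmono thompson1// gK.
  - by move=> c cs; rewrite -fltm -(fltm c) !gK pab// map_f.
exists (- k) => x; rewrite in_itv/= => /andP[ax xb].
have : f (g x) = f (g a) + 2 ^ k * (g x - g a).
  by apply: fk; rewrite in_itv/= -(fmono (g a)) -(fmono (g x)) !gK ax.
rewrite !gK => xE; rewrite [X in _ * (X - a)]xE.
rewrite addrAC subrr add0r mulrA -expfzDr ?pnatr_eq0// addNr expr0z.
by ring.
Qed.

Lemma thompson_invE f : is_thompson f -> exists g, cancel f g /\ cancel g f.
Proof.
move=> fT; have [fout [g [_ fI gI fK gK]] _ _ _ _] := fT.
exists (fun x => if x \in `[0, 1] then g x else x).
split=> x.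
  rewrite thompson_itv//; case: ifPn => xI; first by rewrite fK.
  by rewrite fout.
by case: ifPn => xI; [rewrite gK|rewrite fout].
Qed.

Lemma comp_is_thompson f g : is_thompson f -> is_thompson g ->
  is_thompson (f \o g).
Proof.
move=> fT gT; have [h [gK hK]] := thompson_invE gT.
have hT := inv_is_thompson gT hK.
have [s [ds saff]] := thompson_dyadic_affine fT.
have [t [dt taff]] := thompson_dyadic_affine gT.
apply: (@affine_is_thompson (t ++ map h s)).
- by move=> x xI /=; rewrite (thompson_out gT)// (thompson_out fT).
- by rewrite /= !thompson0.
- by rewrite /= !thompson1.
split=> [c|a b [a0 ab b1 pab]].
  rewrite mem_cat => /orP[/dt//|/mapP[d /ds dd ->]].
  exact/(thompson_dyadic hT).
have gmono := thompson_le gT; have gltm := leW_mono gmono.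
have [|k gk] := taff a b.
  by split=> // c ct; apply: pab; rewrite mem_cat ct.
have [|l fl] := saff (g a) (g b).
  split; rewrite ?gltm//.
  - by rewrite -(thompson0 gT) gmono.
  - by rewrite -(thompson1 gT) gmono.
  - move=> c cs; rewrite -(hK c) !gltm; apply: pab.
    by rewrite mem_cat map_f ?orbT.
exists (l + k) => x xI /=.
rewrite fl; last by move: xI; rewrite !in_itv/= !gmono.
rewrite (gk _ xI) addrAC subrr add0r mulrA -expfzDr ?pnatr_eq0//.
Qed.

Record thompson := Thompson {
  thompson_fun :> R -> R;
  thompsonP : is_thompson thompson_fun }.

Lemma thompson_ext (a b : thompson) : a =1 b -> a = b.
Proof.
case: a b => [f fT] [g gT] /= /funext fg; subst g.
by congr Thompson; exact: Prop_irrelevance.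
Qed.

HB.instance Definition _ := gen_eqMixin thompson.
HB.instance Definition _ := gen_choiceMixin thompson.

Definition thompson_one : thompson := Thompson id_is_thompson.

Definition thompson_mul (a b : thompson) : thompson :=
  Thompson (comp_is_thompson (thompsonP a) (thompsonP b)).

Lemma thompson_has_inv (a : thompson) : exists b : thompson,
  cancel a b /\ cancel b a.
Proof.
have [g [gK Kg]] := thompson_invE (thompsonP a).
by exists (Thompson (inv_is_thompson (thompsonP a) Kg)).
Qed.

Definition thompson_inv (a : thompson) : thompson := sval (cid (thompson_has_inv a)).

Lemma thompson_mulA : associative thompson_mul.
Proof. by move=> a b c; exact: thompson_ext. Qed.

Lemma thompson_mul1 : left_id thompson_one thompson_mul.
Proof. by move=> a; exact: thompson_ext. Qed.

Lemma thompson_mulr1 : right_id thompson_one thompson_mul.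
Proof. by move=> a; exact: thompson_ext. Qed.

Lemma thompson_mulVr : left_inverse thompson_one thompson_inv thompson_mul.
Proof.
by move=> a; apply: thompson_ext => x; exact: (svalP (cid (thompson_has_inv a))).1.
Qed.

Lemma thompson_mulrV : right_inverse thompson_one thompson_inv thompson_mul.
Proof.
by move=> a; apply: thompson_ext => x; exact: (svalP (cid (thompson_has_inv a))).2.
Qed.

HB.instance Definition _ := isGroup.Build thompson
  thompson_mulA thompson_mul1 thompson_mulr1 thompson_mulVr thompson_mulrV.

Definition x0_fun (t : R) : R :=
  if t \notin `[0, 1] then t
  else if t <= 1 / 2 then t / 2
  else if t <= 3 / 4 then t - 1 / 4
  else 2 * t - 1.

Definition x1_fun (t : R) : R :=
  if t \notin `[0, 1] then t
  else if t <= 1 / 2 then t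
  else if t <= 3 / 4 then t / 2 + 1 / 4
  else if t <= 7 / 8 then t - 1 / 8
  else 2 * t - 1.

Lemma itv01 (t : R) : 0 <= t -> t <= 1 -> (t \in `[0, 1]) = true.
Proof. by rewrite in_itv/= => -> ->. Qed.

Lemma x0_is_thompson : is_thompson x0_fun.
Proof.
apply: (@affine_is_thompson [:: 1 / 2; 3 / 4]).
- by move=> x xI; rewrite /x0_fun xI.
- by rewrite /x0_fun itv01 ?ler01//=; do ?(case: leP => ?); lra.
- by rewrite /x0_fun itv01 ?ler01//=; do ?(case: leP => ?); lra.
split=> [c|a b [a0 ab b1 pab]].
  rewrite !inE => /orP[]/eqP ->; [exists 1, 1%N|exists 3, 2%N]; lra.
have := pab (1 / 2); have := pab (3 / 4).
rewrite !inE !eqxx !orbT => /(_ erefl) p2 /(_ erefl) p1.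
have xI x : x \in `[a, b] -> x \in `[0, 1] by rewrite !in_itv/=; lra.
have aab : a \in `[a, b] by rewrite in_itv/= lexx ltW.
have [b2|b2] := leP b (1 / 2).
  clear p1 p2.
  have E x : x \in `[a, b] -> x0_fun x = x / 2.
    move=> /[dup] /xI x01; rewrite /x0_fun x01/= in_itv/= => xab.
    by do ?(case: leP => ?; try lra).
  exists (-1) => x xab; rewrite !E// exprN1; lra.
have {b2}p1 : 1 / 2 <= a by move: p1; rewrite b2 andbT -leNgt.
have [b3|b3] := leP b (3 / 4).
  clear p2.
  have E x : x \in `[a, b] -> x0_fun x = x - 1 / 4.
    move=> /[dup] /xI x01; rewrite /x0_fun x01/= in_itv/= => xab.
    by do ?(case: leP => ?; try lra).
  exists 0 => x xab; rewrite !E// expr0z; lra.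
have {b3}p2 : 3 / 4 <= a by move: p2; rewrite b3 andbT -leNgt.
have E x : x \in `[a, b] -> x0_fun x = 2 * x - 1.
  move=> /[dup] /xI x01; rewrite /x0_fun x01/= in_itv/= => xab.
  by do ?(case: leP => ?; try lra).
exists 1 => x xab; rewrite !E// expr1z; lra.
Qed.

Lemma x1_is_thompson : is_thompson x1_fun.
Proof.
apply: (@affine_is_thompson [:: 1 / 2; 3 / 4; 7 / 8]).
- by move=> x xI; rewrite /x1_fun xI.
- by rewrite /x1_fun itv01 ?ler01//=; do ?(case: leP => ?); lra.
- by rewrite /x1_fun itv01 ?ler01//=; do ?(case: leP => ?); lra.
split=> [c|a b [a0 ab b1 pab]].
  rewrite !inE => /or3P[]/eqP ->; [exists 1, 1%N|exists 3, 2%N|exists 7, 3%N]; lra.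
have := pab (1 / 2); have := pab (3 / 4); have := pab (7 / 8).
rewrite !inE !eqxx !orbT => /(_ erefl) p3 /(_ erefl) p2 /(_ erefl) p1.
have xI x : x \in `[a, b] -> x \in `[0, 1] by rewrite !in_itv/=; lra.
have aab : a \in `[a, b] by rewrite in_itv/= lexx ltW.
have [b2|b2] := leP b (1 / 2).
  clear p1 p2 p3.
  have E x : x \in `[a, b] -> x1_fun x = x.
    move=> /[dup] /xI x01; rewrite /x1_fun x01/= in_itv/= => xab.
    by do ?(case: leP => ?; try lra).
  exists 0 => x xab; rewrite !E// expr0z; lra.
have {b2}p1 : 1 / 2 <= a by move: p1; rewrite b2 andbT -leNgt.
have [b3|b3] := leP b (3 / 4).
  clear p2 p3.
  have E x : x \in `[a, b] -> x1_fun x = x / 2 + 1 / 4.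
    move=> /[dup] /xI x01; rewrite /x1_fun x01/= in_itv/= => xab.
    by do ?(case: leP => ?; try lra).
  exists (-1) => x xab; rewrite !E// exprN1; lra.
have {b3}p2 : 3 / 4 <= a by move: p2; rewrite b3 andbT -leNgt.
have [b4|b4] := leP b (7 / 8).
  clear p3.
  have E x : x \in `[a, b] -> x1_fun x = x - 1 / 8.
    move=> /[dup] /xI x01; rewrite /x1_fun x01/= in_itv/= => xab.
    by do ?(case: leP => ?; try lra).
  exists 0 => x xab; rewrite !E// expr0z; lra.
have {b4}p3 : 7 / 8 <= a by move: p3; rewrite b4 andbT -leNgt.
have E x : x \in `[a, b] -> x1_fun x = 2 * x - 1.
  move=> /[dup] /xI x01; rewrite /x1_fun x01/= in_itv/= => xab.
  by do ?(case: leP => ?; try lra).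
exists 1 => x xab; rewrite !E// expr1z; lra.
Qed.

Definition thompson_x0 : thompson := Thompson x0_is_thompson.
Definition thompson_x1 : thompson := Thompson x1_is_thompson.

Definition supp (f : R -> R) : set R := [set x | x \in `[0, 1] /\ f x <> x].

Definition H_lt1 : set thompson := [set f | ~ closure (supp f) 1].

End Thompson.

(* Main.v *)
Require Import Defs.
From mathcomp Require Import all_boot all_order all_algebra.
From mathcomp Require Import all_classical all_reals all_analysis.
From mathcomp Require Import ring lra zify.

(* Take for [g_n] a high power of a product of bumps supported on consecutive
   dyadic intervals [1 - p_i, 1 - p_(i+1)] shrinking to 1. Each element of
   [H_lt1] is the identity near 1, hence commutes with [g_n] for [n] large, so
   every relation of the HNN-extension holds eventually. An element outside
   [H_lt1] acts near 1 as a nontrivial scaling by a power of 2 of the distance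
   to 1. As the ratios p_i / p_(i+1) exceed 2^n, such a scaling pushes a
   neighbourhood of the marked points p_i into the gaps between them, while a
   nonzero power of [g_n] pushes the gaps back into that neighbourhood; by
   ping-pong a Britton-reduced word evaluated at [g_n] is eventually nontrivial.
   Since every element has a reduced form, this gives the convergence without
   Britton's lemma.

   That [x0] and [x1] generate the whole group is seen on dyadic partitions:
   every partition obtained by halvings is carried to the all-right one by the
   group they generate, and every [f] maps some such partition affinely onto a
   uniform grid, which is again obtained by halvings. *)

Set Implicit Arguments.
Unset Strict Implicit.
Unset Printing Implicit Defensive.

Import Order.TTheory GRing.Theory Num.Theory.
Import numFieldNormedType.Exports.

Local Open Scope classical_set_scope.
Local Open Scope ring_scope.

(** * The standard generators, piece by piece *)

Section ThompsonAction.
Variable R : realType.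
Implicit Types f g h : thompson R.

Lemma thompsonM f g x : (f * g)%g x = f (g x).
Proof. by []. Qed.

Lemma thompson_1E x : (1%g : thompson R) x = x.
Proof. by []. Qed.

Lemma thompsonK f : cancel f (f^-1)%g.
Proof. by move=> x; rewrite -thompsonM mulVg. Qed.

Lemma thompsonVK f : cancel (f^-1)%g f.
Proof. by move=> x; rewrite -thompsonM mulgV. Qed.

Lemma thompsonV_eq f x y : f x = y -> (f^-1)%g y = x.
Proof. by move=> <-; rewrite thompsonK. Qed.

Lemma thompson_mono f : {mono f : x y / x <= y}.
Proof. exact: thompson_le (thompsonP f). Qed.

Lemma x0_lo (t : R) : 0 <= t <= 1 / 2 -> thompson_x0 R t = t / 2.
Proof.
move=> tI; rewrite /= /x0_fun in_itv /=.
have -> /= : 0 <= t <= 1 by lra.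
by do 1?(case: leP => ?; try lra).
Qed.

Lemma x0_mid (t : R) : 1 / 2 <= t <= 3 / 4 -> thompson_x0 R t = t - 1 / 4.
Proof.
move=> tI; rewrite /= /x0_fun in_itv /=.
have -> /= : 0 <= t <= 1 by lra.
by do 2?(case: leP => ?; try lra).
Qed.

Lemma x0_hi (t : R) : 3 / 4 <= t <= 1 -> thompson_x0 R t = 2 * t - 1.
Proof.
move=> tI; rewrite /= /x0_fun in_itv /=.
have -> /= : 0 <= t <= 1 by lra.
by do 2?(case: leP => ?; try lra).
Qed.

Lemma x1_lo (t : R) : t <= 1 / 2 -> thompson_x1 R t = t.
Proof.
move=> tI; rewrite /= /x1_fun; case: ifP => // _.
by do 2?(case: leP => ?; try lra).
Qed.

Lemma x1_mid (t : R) : 1 / 2 <= t <= 3 / 4 ->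
  thompson_x1 R t = t / 2 + 1 / 4.
Proof.
move=> tI; rewrite /= /x1_fun in_itv /=.
have -> /= : 0 <= t <= 1 by lra.
by do 2?(case: leP => ?; try lra).
Qed.

Lemma x1_mid' (t : R) : 3 / 4 <= t <= 7 / 8 -> thompson_x1 R t = t - 1 / 8.
Proof.
move=> tI; rewrite /= /x1_fun in_itv /=.
have -> /= : 0 <= t <= 1 by lra.
by do 3?(case: leP => ?; try lra).
Qed.

Lemma x1_hi (t : R) : 7 / 8 <= t <= 1 -> thompson_x1 R t = 2 * t - 1.
Proof.
move=> tI; rewrite /= /x1_fun in_itv /=.
have -> /= : 0 <= t <= 1 by lra.
by do 3?(case: leP => ?; try lra).
Qed.

End ThompsonAction.

(** * Dyadic subdivisions and maps affine on their cells *)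

Section Halving.
Variable R : realType.
Implicit Types (a b c t : R) (u v l r : seq R) (f g h : R -> R).

(** The barycentric parameter avoids naming a slope, makes composition immediate and tolerates
    degenerate intervals. *)
Definition affine_on f a b : Prop := forall t, 0 <= t <= 1 ->
  f (a + t * (b - a)) = f a + t * (f b - f a).

Lemma affine_on_comp f g a b : affine_on f a b -> affine_on g (f a) (f b) ->
  affine_on (g \o f) a b.
Proof. by move=> fA gA t tI /=; rewrite fA// gA. Qed.

Lemma affine_on_formula f a b (m q x y : R) :
  (forall t, a <= t <= b -> f t = m * t + q) ->
  a <= x <= b -> a <= y <= b -> affine_on f x y.
Proof.
move=> fE xI yI t tI; rewrite !fE//; last by nra.
by ring.
Qed.

Lemma affine_on_half f a b : affine_on f a b ->
  [/\ f ((a + b) / 2) = (f a + f b) / 2, affine_on f a ((a + b) / 2) &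
      affine_on f ((a + b) / 2) b].
Proof.
move=> fA.
have fm : f ((a + b) / 2) = (f a + f b) / 2.
  have -> : (a + b) / 2 = a + 1 / 2 * (b - a) by field.
  by rewrite fA; [field|lra].
split=> // t tI; rewrite fm.
  have -> : a + t * ((a + b) / 2 - a) = a + (t / 2) * (b - a) by field.
  by rewrite fA; [field|lra].
have -> : (a + b) / 2 + t * (b - (a + b) / 2) = a + ((1 + t) / 2) * (b - a).
  by field.
by rewrite fA; [field|lra].
Qed.

Fixpoint affine_along f a u : Prop :=
  if u is b :: u' then affine_on f a b /\ affine_along f b u' else True.

Lemma affine_along_cat f a u v : affine_along f a u ->
  affine_along f (last a u) v -> affine_along f a (u ++ v).
Proof. by elim: u a => //= b u IH a [fab fu] fv; split=> //; exact: IH. Qed.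

Lemma affine_along_formula f a b (m q x : R) u :
  (forall t, a <= t <= b -> f t = m * t + q) ->
  a <= x <= b -> {in u, forall y, a <= y <= b} -> affine_along f x u.
Proof.
move=> fE; elim: u x => //= y u IH x xI uI.
have yI : a <= y <= b by apply: uI; exact: mem_head.
split; first exact: affine_on_formula fE _ _.
by apply: IH => // z zu; apply: uI; rewrite inE zu orbT.
Qed.

(* [g] sends the consecutive points of [a :: u] affinely to 1 - 2^-i,
   1 - 2^-(i+1), ..., 1 - 2^-m, 1; for [i = 0] these are the end points of the
   leaves of an all-right tree. *)
Fixpoint to_vine g i a u : Prop :=
  if u is b :: u' then
    [/\ g a = 1 - (2 ^+ i)^-1, affine_on g a b & to_vine g i.+1 b u']
  else g a = 1.

(* Partitions are listed without their left end point [a]. *)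
Inductive halving : R -> R -> seq R -> Prop :=
| halving_leaf a b : halving a b [:: b]
| halving_node a b u v : halving a ((a + b) / 2) u ->
    halving ((a + b) / 2) b v -> halving a b (u ++ v).

Lemma halving_last a b u : halving a b u -> forall c, last c u = b.
Proof. by elim=> // {}a {}b {}u v _ _ _ IH c; rewrite last_cat IH. Qed.

(** A uniform grid with [2 ^ e] cells is the leaf set of the complete binary tree of depth [e]; the
    induction splits it at its midpoint. *)
Lemma halving_uniform e a (d : R) :
  halving a (a + 2 ^+ e * d) [seq a + d * j%:R | j <- iota 1 (2 ^ e)].
Proof.
elim: e a => [|e IH] a /=.
  by rewrite expr0 mul1r mulr1; exact: halving_leaf.
have m : (a + (a + 2 ^+ e.+1 * d)) / 2 = a + 2 ^+ e * d.
  by rewrite exprS; field.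
rewrite expnS mul2n -addnn iotaD map_cat; apply: halving_node; rewrite m//.
have -> : a + 2 ^+ e.+1 * d = (a + 2 ^+ e * d) + 2 ^+ e * d.
  by rewrite exprS; ring.
have := IH (a + 2 ^+ e * d); congr halving.
rewrite [in RHS]addnC iotaDl -map_comp; apply: eq_map => j /=.
by rewrite natrD natrX; ring.
Qed.

(** On each cell both [g' \o f] and [g] are affine, and they take the same values at the end points,
    which the vine prescribes. *)
Lemma to_vine_unique g g' f i a u : affine_along f a u ->
  to_vine g i a u -> to_vine g' i (f a) (map f u) ->
  forall t, a <= t <= last a u -> g' (f t) = g t.
Proof.
elim: u i a => [|b u IH] i a /=.
  move=> _ ga g'a t tI; have -> : t = a by lra.
  by rewrite ga.
move=> [fab fu] [ga gab gu] [g'a g'ab g'u] t /andP[at1 tl].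
have [tb|bt] := leP t b; last first.
  by apply: IH fu gu g'u _ _; rewrite tl (ltW bt).
have gb : g' (f b) = g b.
  by case: (u) gu g'u => [|c w] /=; [move=> -> ->|move=> [-> _ _] [->]].
have [s sI ->] : exists2 s, 0 <= s <= 1 & t = a + s * (b - a).
  have [ab|ba] := ltP a b.
    exists ((t - a) / (b - a)); last by field; lra.
    by rewrite ler_pdivrMr ?divr_ge0 ?mul1r /=; lra.
  by exists 0; lra.
by rewrite fab// g'ab// gab// gb ga g'a.
Qed.

End Halving.

(** * Generation of the group by [x0] and [x1] *)

Section Generation.
Variable R : realType.
(** An abstract closed predicate serves twice: for the span of the marking in the group itself, and
    for the preimage of the span in the HNN-extension. *)
Variable P : set (thompson R).
Hypothesis P0 : P (thompson_x0 R).
Hypothesis P1 : P (thompson_x1 R).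
Hypothesis PM : forall f g, P f -> P g -> P (f * g)%g.
Hypothesis PV : forall f, P f -> P (f^-1)%g.

Lemma closed_one : P 1%g.
Proof. by rewrite -(mulgV (thompson_x0 R)); apply: PM => //; exact: PV. Qed.

Lemma inv_pow2_gt0 n : 0 < (2 ^+ n)^-1 :> R.
Proof. by rewrite invr_gt0 exprn_gt0. Qed.

Lemma inv_pow2S n : (2 ^+ n.+1)^-1 = (2 ^+ n)^-1 / 2 :> R.
Proof. by rewrite exprS invfM mulrC. Qed.

Lemma inv_pow2_le1 n : (2 ^+ n)^-1 <= 1 :> R.
Proof. by rewrite invf_le1 ?exprn_gt0// exprn_ege1// ler1n. Qed.

(* The action, for [e = 2^-k], of the [k]-th generator of the infinite
   presentation (inverted): halving the [k]-th vine interval and then applying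
   it yields the vine with one more leaf. *)
Definition shift_spec (f : thompson R) (e : R) : Prop :=
  [/\ forall t, t <= 1 - e -> f t = t,
      forall t, 1 - e <= t <= 1 - 3 / 4 * e -> f t = 2 * t - (1 - e),
      forall t, 1 - 3 / 4 * e <= t <= 1 - e / 2 -> f t = t + e / 4 &
      forall t, 1 - e / 2 <= t <= 1 -> f t = (1 + t) / 2].

(** The inverses of [x0] and [x1] settle the first two cases. Near 1, [x0] doubles the distance to
    1, so conjugating by it replaces [e] by [e / 2]. *)
Lemma shift_spec_exists k : exists2 f, P f & shift_spec f (2 ^+ k)^-1.
Proof.
case: k => [|k].
  exists (thompson_x0 R)^-1%g; first exact: PV.
  rewrite expr0 invr1; split=> t tI; apply: thompsonV_eq.
  - have [->|t0] := eqVneq t 0; first by rewrite x0_lo; lra.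
    have tneg : t < 0 by rewrite lt_neqAle t0/=; lra.
    by rewrite (thompson_out (thompsonP _))// in_itv/=; apply/negP; lra.
  - by rewrite x0_lo; lra.
  - by rewrite x0_mid; lra.
  - by rewrite x0_hi; lra.
elim: k => [|k [f Pf fE]].
  exists (thompson_x1 R)^-1%g; first exact: PV.
  rewrite expr1; split=> t tI; apply: thompsonV_eq.
  - by rewrite x1_lo; lra.
  - by rewrite x1_mid; lra.
  - by rewrite x1_mid'; lra.
  - by rewrite x1_hi; lra.
exists ((thompson_x0 R)^-1 * (f * thompson_x0 R))%g.
  by apply: PM; [exact: PV|exact: PM].
rewrite inv_pow2S; move: fE; set e := (2 ^+ _)^-1 => -[f1 f2 f3 f4].
have e0 : 0 < e by exact: inv_pow2_gt0.
have e1 : e <= 1 / 2.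
  by rewrite /e inv_pow2S; have := inv_pow2_le1 k; lra.
split=> t tI; rewrite !thompsonM; apply: thompsonV_eq.
(* Up to 3/4, where [x0] is not yet the doubling, its values are at most 1/2 and hence fixed by [f],
   because [e <= 1 / 2]. *)
- have [t34|t34] := leP t (3 / 4).
    rewrite f1//; apply: le_trans (_ : thompson_x0 R (3 / 4) <= _).
      by rewrite thompson_mono.
    by rewrite x0_hi; lra.
  by rewrite f1 ?x0_hi; lra.
- by rewrite [X in f X]x0_hi ?f2 ?x0_hi; lra.
- by rewrite [X in f X]x0_hi ?f3 ?x0_hi; lra.
- by rewrite [X in f X]x0_hi ?f4 ?x0_hi; lra.
Qed.

(** On the last stretch [h] halves the distance to 1, which moves each vine point to the next
    one. *)
Lemma to_vine_shift g h e i a u : shift_spec h e -> (2 ^+ i)^-1 <= e / 2 ->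
  to_vine g i a u -> to_vine (h \o g) i.+1 a u.
Proof.
move=> [_ _ _ h4]; elim: u i a => [|b u IH] i a ie.
  by move=> /= ->; rewrite h4; have := inv_pow2_gt0 i; lra.
move=> /= [ga gab gu]; have i0 := inv_pow2_gt0 i.
have hA : forall x y, 1 - e / 2 <= x <= 1 -> 1 - e / 2 <= y <= 1 ->
    affine_on h x y.
  move=> x y; apply: (@affine_on_formula _ _ _ _ (1 / 2) (1 / 2)) => t tI.
  by rewrite h4; lra.
split.
- by rewrite ga h4 ?inv_pow2S; lra.
- apply: affine_on_comp gab _; apply: hA; first lra.
  case: (u) gu => [|c w] /= => [->|[-> _ _]]; first lra.
  by have := inv_pow2_gt0 i.+1; rewrite inv_pow2S; lra.
- by apply: IH gu; rewrite inv_pow2S; lra.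
Qed.

(** Halving the last leaf of a vine yields a vine, so [g] is kept. For any other leaf, [g] is
    followed by the shift based at the left end of its image, which opens one more vine interval
    there. *)
Lemma to_vine_split g i a l b r : P g -> to_vine g i a (l ++ b :: r) ->
  exists2 h, P h & to_vine h i a (l ++ (last a l + b) / 2 :: b :: r).
Proof.
move=> Pg; case: r => [|c r].
  exists g => //; elim: l i a H => [|d l IH] i a /=.
    move=> [ga gab gb]; have [gm am mb] := affine_on_half gab.
    by split=> //; split=> //; rewrite gm ga gb inv_pow2S; lra.
  by move=> [ga gad gl]; split=> //; exact: IH.
have [h Ph hS] := shift_spec_exists (i + size l).
move=> H; exists (h * g)%g; first exact: PM.
elim: l i a H hS => [|d l IH] i a /=; last first.
  move=> [ga gad gl]; rewrite addnS -addSn => hS.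
  have [h1 _ _ _] := hS.
  have ile : (2 ^+ (i.+1 + size l))^-1 <= (2 ^+ i.+1)^-1 :> R.
    by rewrite lef_pV2 ?posrE ?exprn_gt0// ler_eXn2l ?ltr1n// leq_addr.
  have iS := inv_pow2S i; have i0 := inv_pow2_gt0 i.
  have gd : g d = 1 - (2 ^+ i.+1)^-1 by case: (l) gl => [|y w] /= [].
  split; [|apply: affine_on_comp gad _|exact: IH].
    by rewrite /= ga h1//; lra.
  apply: (@affine_on_formula _ _ 0 (1 - (2 ^+ (i.+1 + size l))^-1) 1 0).
  - by move=> t tI; rewrite h1; lra.
  - by rewrite ga; have := inv_pow2_le1 i; lra.
  - by rewrite gd; have := inv_pow2_le1 i; lra.
move=> [ga gab [gb gbc gr]]; rewrite addn0 => hS; have [h1 h2 h3 h4] := hS.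
have iS := inv_pow2S i; have i0 := inv_pow2_gt0 i.
have [gm am mb] := affine_on_half gab.
rewrite ga gb iS in gm.
have hA1 : affine_on h (g a) (g ((a + b) / 2)).
  apply: (@affine_on_formula _ _ (1 - (2 ^+ i)^-1) (1 - 3 / 4 * (2 ^+ i)^-1)
     2 (- (1 - (2 ^+ i)^-1))); rewrite ?ga ?gm; try lra.
  by move=> t tI; rewrite h2.
have hA2 : affine_on h (g ((a + b) / 2)) (g b).
  apply: (@affine_on_formula _ _ (1 - 3 / 4 * (2 ^+ i)^-1) (1 - (2 ^+ i)^-1 / 2)
     1 ((2 ^+ i)^-1 / 4)); rewrite ?gb ?gm ?iS; try lra.
  by move=> t tI; rewrite h3; lra.
split; [by rewrite /= ga h1|exact: affine_on_comp|split].
- by rewrite /= gm h2 ?iS; lra.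
- exact: affine_on_comp.
- by apply: (@to_vine_shift g h _ i.+1 b (c :: r) hS) => //; rewrite iS.
Qed.

(** The tree of halvings is grown from its root one split at a time; [l] and [r] are the leaves on
    either side of the one being subdivided. *)
Lemma halving_to_vine a b u : halving a b u -> forall g i c l r, P g ->
  last c l = a -> to_vine g i c (l ++ b :: r) ->
  exists2 h, P h & to_vine h i c (l ++ u ++ r).
Proof.
elim=> {a b u} [a b|a b u v uH IHu vH IHv] g i c l r Pg lc gl.
  by exists g.
have [h1 Ph1] := to_vine_split Pg gl; rewrite lc => /(IHu _ _ _ _ _ Ph1 lc).
move=> [h2 Ph2]; rewrite catA => /(IHv _ _ _ _ _ Ph2).
rewrite last_cat (halving_last uH) => /(_ erefl)[h3 Ph3 h3E].
by exists h3 => //; rewrite -catA -[(u ++ v) ++ r]catA in h3E *.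
Qed.

Lemma halving01_to_vine u : halving 0 1 u ->
  exists2 h, P h & to_vine h 0 (0 : R) u.
Proof.
move=> uH; have [] := @halving_to_vine _ _ _ uH 1%g 0 0 [::] [::] closed_one.
- by [].
- by split=> //=; rewrite ?expr0 ?invr1 ?subrr.
- by move=> h Ph; rewrite /= cats0; exists h.
Qed.

Definition grid (N : nat) (x : R) (n : nat) : seq R :=
  [seq x + j%:R / 2 ^+ N | j <- iota 1 n].

Lemma gridD N x m n :
  grid N x (m + n) = grid N x m ++ grid N (x + m%:R / 2 ^+ N) n.
Proof.
rewrite /grid iotaD map_cat addnC iotaDl -map_comp; congr (_ ++ _).
by apply: eq_map => j /=; rewrite natrD mulrDl addrA.
Qed.

(** The mesh [N] is a parameter so that adjacent pieces can be given a common one and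
    concatenated. *)
Definition halving_to_grid (f : R -> R) a b N : Prop :=
  exists u n, [/\ halving a b u, affine_along f a u,
    map f u = grid N (f a) n & f b = f a + n%:R / 2 ^+ N].

Lemma halving_to_grid_node f a b N : halving_to_grid f a ((a + b) / 2) N ->
  halving_to_grid f ((a + b) / 2) b N -> halving_to_grid f a b N.
Proof.
move=> [u [m [uH uA uE fm]]] [v [n [vH vA vE fb]]].
exists (u ++ v), (m + n)%N; split.
- exact: halving_node.
- by apply: affine_along_cat => //; rewrite (halving_last uH).
- by rewrite map_cat gridD uE vE fm.
- by rewrite fb fm natrD mulrDl addrA.
Qed.

Lemma halving_to_grid_affine f (a : R) d (k : int) N :
  (forall t, a <= t <= a + (2 ^+ d)^-1 -> f t = f a + 2 ^ k * (t - a)) ->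
  (`|k| + d <= N)%N -> halving_to_grid f a (a + (2 ^+ d)^-1) N.
Proof.
move=> fE kN.
(* Cutting a cell of length 2^-d into 2^e equal parts gives images of length 2^(k-d-e), which is to
   be 2^-N; the bound on [N] makes [e] nonnegative. *)
have [e eE] : exists e : nat, e%:Z = N%:Z + k - d%:Z.
  by exists (absz (N%:Z + k - d%:Z)%R); lia.
pose D : R := (2 ^+ (d + e))^-1.
have D0 : 0 < D by exact: inv_pow2_gt0.
have n2 : 2 != 0 :> R by [].
have eD : 2 ^+ e * D = (2 ^+ d)^-1.
  by rewrite /D exprD invfM mulrCA mulfV ?mulr1// expf_neq0.
have kD : 2 ^ k * D = (2 ^+ N)^-1.
  rewrite /D !exprnN -expfzDr//; congr (_ ^ _); lia.
have uI : {in [seq a + D * j%:R | j <- iota 1 (2 ^ e)],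
    forall y, a <= y <= a + (2 ^+ d)^-1}.
  move=> _ /mapP[j + ->]; rewrite mem_iota => /andP[_ je].
  have j0 : 0 <= j%:R :> R by rewrite ler0n.
  have j2 : j%:R <= 2 ^+ e :> R by rewrite -natrX ler_nat.
  by rewrite -eD; apply/andP; split; nra.
exists [seq a + D * j%:R | j <- iota 1 (2 ^ e)], (2 ^ e)%N; split.
- by have := halving_uniform e a D; rewrite eD.
- apply: (@affine_along_formula _ f a (a + (2 ^+ d)^-1) (2 ^ k)
    (f a - 2 ^ k * a)) => //.
    by move=> t tI; rewrite fE//; ring.
  by rewrite lexx lerDl ltW// inv_pow2_gt0.
- rewrite /grid -map_comp; apply/eq_in_map => j jI /=.
  rewrite fE; last by apply: uI; exact: map_f.
  by rewrite -kD; ring.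
- rewrite fE ?lexx ?andbT; last by rewrite lerDl ltW// inv_pow2_gt0.
  by rewrite -eD natrX -kD; ring.
Qed.

Lemma dyadic_common_denominator (s : seq R) : {in s, forall c, dyadic c} ->
  exists N : nat, {in s, forall c, exists z : int, c = z%:~R / 2 ^+ N}.
Proof.
elim: s => [|c s IH] sd; first by exists 0%N.
have [|N NE] := IH; first by move=> x xs; apply: sd; rewrite inE xs orbT.
have [z [n cE]] := sd c (mem_head _ _).
exists (N + n)%N => x; rewrite inE => /orP[/eqP->|/NE[y ->]].
  exists (z * 2 ^+ N); rewrite cE intrM rmorphXn/= exprD.
  by field; rewrite !expf_neq0.
exists (y * 2 ^+ n); rewrite intrM rmorphXn/= exprD.
by field; rewrite !expf_neq0.
Qed.

Lemma thompson_halving_to_grid (f : thompson R) :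
  exists N, halving_to_grid f 0 1 N.
Proof.
have [s [sd sA]] := thompson_dyadic_affine (thompsonP f).
have [N0 N0E] := dyadic_common_denominator sd.
(* Induction on the number [j] of levels above depth [N0], where no breakpoint is interior to a
   cell. Allowing every large [N] lets the two halves of a cell agree on one mesh. *)
have main j d (z : int) : (j + d = N0)%N -> 0 <= z%:~R / 2 ^+ d :> R ->
    (z + 1)%:~R / 2 ^+ d <= 1 :> R -> exists M, forall N, (M <= N)%N ->
    halving_to_grid f (z%:~R / 2 ^+ d) ((z + 1)%:~R / 2 ^+ d) N.
  elim: j d z => [|j IH] d z jd z0 z1.
    have zS : (z + 1)%:~R / 2 ^+ d = z%:~R / 2 ^+ d + (2 ^+ d)^-1 :> R.
      by rewrite intrD mulrDl mul1r.
    have d0 := inv_pow2_gt0 d.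
    have [|k kE] := sA (z%:~R / 2 ^+ d) ((z + 1)%:~R / 2 ^+ d).
      split=> //; first by rewrite zS ltrDl.
      move=> c /N0E[y ->]; rewrite -jd add0n !ltr_pM2r// !ltr_int; lia.
    exists (`|k| + d)%N => N kN; rewrite zS.
    apply: halving_to_grid_affine kN => t tI; apply: kE.
    by rewrite in_itv/= zS.
  have n2 : 2 ^+ d != 0 :> R by rewrite expf_neq0.
  have zE : z%:~R / 2 ^+ d = (z * 2)%:~R / 2 ^+ d.+1 :> R.
    by rewrite intrM exprS; field.
  have zSE : (z + 1)%:~R / 2 ^+ d = (z * 2 + 1 + 1)%:~R / 2 ^+ d.+1 :> R.
    by rewrite !intrD intrM exprS; field.
  have mE : (z%:~R / 2 ^+ d + (z + 1)%:~R / 2 ^+ d) / 2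
      = (z * 2 + 1)%:~R / 2 ^+ d.+1 :> R.
    by rewrite !intrD intrM exprS; field.
  have d0 := inv_pow2_gt0 d.+1.
  have [||| M1 H1] := IH d.+1 (z * 2).
  - by rewrite addnS.
  - by rewrite -zE.
  - by apply: le_trans z1; rewrite zSE ler_pM2r// ler_int; lia.
  have [||| M2 H2] := IH d.+1 (z * 2 + 1).
  - by rewrite addnS.
  - by apply: le_trans z0 _; rewrite zE ler_pM2r// ler_int; lia.
  - by rewrite -zSE.
  exists (maxn M1 M2) => N; rewrite geq_max => /andP[/H1 + /H2].
  by rewrite -zE -zSE -mE; exact: halving_to_grid_node.
have [||| M HM] := main N0 0%N 0.
- by rewrite addn0.
- by rewrite mul0r.
- by rewrite expr0 divr1.
by exists M; have := HM M (leqnn M); rewrite add0r expr0 mul0r divr1.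
Qed.

(** Both the subdivision [u] and its image under [f] are halvings of the unit interval, so elements
    [g] and [g'] of [P] carry them to the same vine; then [g' * f = g]. *)
Lemma thompson_generated (f : thompson R) : P f.
Proof.
have [N [u [n [uH uA uE fn]]]] := thompson_halving_to_grid f.
have f0 := thompson0 (thompsonP f); have f1 := thompson1 (thompsonP f).
(* As [f] fixes 0 and 1, the image grid fills the unit interval. *)
have nE : n = (2 ^ N)%N.
  apply/eqP; rewrite -(eqr_nat R) natrX; apply/eqP.
  have N2 : 2 ^+ N != 0 :> R by rewrite expf_neq0.
  by have := fn; rewrite f1 f0 add0r => /(congr1 ( *%R^~ (2 ^+ N)));
     rewrite mul1r divfK.
have vH : halving 0 1 (map f u).
  have := halving_uniform N 0 (2 ^+ N)^-1 : halving (0 : R) _ _.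
  rewrite mulfV ?expf_neq0// add0r uE f0 nE; congr halving.
  by apply: eq_map => j; rewrite mulrC.
have [g Pg gu] := halving01_to_vine uH.
have [g' Pg' g'u] := halving01_to_vine vH.
have -> : f = (g'^-1 * g)%g; last by apply: PM => //; exact: PV.
apply: (mulgI g'); rewrite mulVKg; apply: thompson_ext => t.
rewrite thompsonM; have [tI|tI] := boolP (t \in `[0, 1]).
  apply: (to_vine_unique uA gu); first by rewrite f0.
  by move: tI; rewrite in_itv (halving_last uH).
by rewrite !(thompson_out (thompsonP _)).
Qed.

End Generation.

(** * The approximating elements and their dynamics near 1 *)

Section PingPong.
Variable R : realType.

(* On [u, v] the successive slopes are 2, 1 and 1/2; elsewhere it is the
   identity. *)
Definition bump_fun (u v e t : R) : R :=
  t + Num.max 0 (Num.min (Num.min (t - u) e) ((v - t) / 2)).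

Lemma bump_fun_out (u v e t : R) : 0 < e -> 3 * e <= v - u ->
  t <= u \/ v <= t -> bump_fun u v e t = t.
Proof.
rewrite /bump_fun => e0 euv [] tI;
  by case: (leP (t - u) e) => ?; case: (leP _ ((v - t) / 2)) => ?;
     case: (leP 0 _) => ?; lra.
Qed.

Lemma bump_fun_left (u v e t : R) : 0 < e -> 3 * e <= v - u ->
  u <= t <= u + e -> bump_fun u v e t = 2 * t - u.
Proof.
rewrite /bump_fun => e0 euv tI.
by case: (leP (t - u) e) => ?; case: (leP _ ((v - t) / 2)) => ?;
   case: (leP 0 _) => ?; lra.
Qed.

Lemma bump_fun_mid (u v e t : R) : 0 < e -> 3 * e <= v - u ->
  u + e <= t <= v - e - e -> bump_fun u v e t = t + e.
Proof.
rewrite /bump_fun => e0 euv tI.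
by case: (leP (t - u) e) => ?; case: (leP _ ((v - t) / 2)) => ?;
   case: (leP 0 _) => ?; lra.
Qed.

Lemma bump_fun_right (u v e t : R) : 0 < e -> 3 * e <= v - u ->
  v - e - e <= t <= v -> bump_fun u v e t = (t + v) / 2.
Proof.
rewrite /bump_fun => e0 euv tI.
by case: (leP (t - u) e) => ?; case: (leP _ ((v - t) / 2)) => ?;
   case: (leP 0 _) => ?; lra.
Qed.

Lemma bump_is_thompson (u v e : R) : dyadic u -> dyadic v -> dyadic e ->
  0 <= u -> v <= 1 -> 0 < e -> 3 * e <= v - u -> is_thompson (bump_fun u v e).
Proof.
move=> du dv de u0 v1 e0 euv; have dD := @dyadicD R; have dN := @dyadicN R.
have E0 t := @bump_fun_out u v e t e0 euv.
have E1 t := @bump_fun_left u v e t e0 euv.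
have E2 t := @bump_fun_mid u v e t e0 euv.
have E3 t := @bump_fun_right u v e t e0 euv.
apply: (@affine_is_thompson _ [:: u; u + e; v - e - e; v]).
- move=> t; rewrite in_itv/= => /negP tI; apply: E0.
  by case: (leP t u); case: (leP v t); [left|left|right|lra].
- by rewrite E0//; left.
- by rewrite E0//; right.
split=> [c|a b [a0 ab b1 pab]].
  by rewrite !inE => /or4P[]/eqP ->; auto.
have := pab v; have := pab (v - e - e); have := pab (u + e); have := pab u.
rewrite !inE !eqxx !orbT => /(_ erefl) p1 /(_ erefl) p2 /(_ erefl) p3 /(_ erefl) p4.
have [b1'|b1'] := leP b u.
  exists 0 => t; rewrite in_itv/= => tI; rewrite expr0z !E0; try (left; lra).
  lra.
have {}p1 : u <= a by move: p1; rewrite b1' andbT -leNgt.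
have [b2|b2] := leP b (u + e).
  exists 1 => t; rewrite in_itv/= => tI; rewrite expr1z !E1; lra.
have {}p2 : u + e <= a by move: p2; rewrite b2 andbT -leNgt.
have [b3|b3] := leP b (v - e - e).
  exists 0 => t; rewrite in_itv/= => tI; rewrite expr0z !E2; lra.
have {}p3 : v - e - e <= a by move: p3; rewrite b3 andbT -leNgt.
have [b4|b4] := leP b v.
  exists (-1) => t; rewrite in_itv/= => tI; rewrite exprN1 !E3; lra.
have {}p4 : v <= a by move: p4; rewrite b4 andbT -leNgt.
exists 0 => t; rewrite in_itv/= => tI; rewrite expr0z !E0; try (right; lra).
lra.
Qed.

(** Distances to 1 of the marked points. Their ratio 2^(n+2) exceeds every slope 2^k with k at most
    n, by a factor 4 that leaves room for the neighbourhoods. *)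
Definition mark (n i : nat) : R := (2 ^+ (n.+2 * i.+1))^-1.

Lemma mark_gt0 n i : 0 < mark n i.
Proof. exact: inv_pow2_gt0. Qed.

Lemma markS n i : mark n i = 4 * 2 ^+ n * mark n i.+1.
Proof.
rewrite /mark [in RHS]mulnS exprD !exprS; field.
by rewrite !expf_neq0.
Qed.

Lemma pow2_ge1 n : 1 <= 2 ^+ n :> R.
Proof. by rewrite exprn_ege1// ler1n. Qed.

Lemma markS_le n i : 4 * mark n i.+1 <= mark n i.
Proof.
rewrite [leRHS]markS; have := mark_gt0 n i.+1; have := pow2_ge1 n; nra.
Qed.

Lemma mark_anti n i j : (i <= j)%N -> mark n j <= mark n i.
Proof.
by move=> ij; rewrite lef_pV2 ?posrE ?exprn_gt0// ler_eXn2l ?ltr1n// leq_mul.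
Qed.

Lemma mark0_lt n : mark n 0 * 4 = (2 ^+ n)^-1.
Proof.
rewrite /mark muln1 !exprS; field.
by rewrite !expf_neq0.
Qed.

Lemma mark_dyadic n i : dyadic (mark n i).
Proof. by exists 1, (n.+2 * i.+1)%N; rewrite mul1r. Qed.

Lemma bump_mark_is_thompson n i :
  is_thompson (bump_fun (1 - mark n i) (1 - mark n i.+1) (mark n i.+1)).
Proof.
have d1 : dyadic (1 : R) by exists 1, 0%N; rewrite divr1.
have dm := mark_dyadic n; have m0 := mark_gt0 n.
have m1 : mark n i <= 1 by exact: inv_pow2_le1.
have := markS_le n i; have := m0 i.+1 => ? ?.
by apply: bump_is_thompson => //; try lra; apply: dyadicD => //; apply: dyadicN.
Qed.

Definition bump n i : thompson R := Thompson (bump_mark_is_thompson n i).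

Fixpoint bumps n m : thompson R :=
  if m is m'.+1 then (bump n m' * bumps n m')%g else 1%g.

(* Between the neighbourhoods of two consecutive marks a bump moves every point
   by at least [mark n n.*2 / 16]; the exponent is the inverse of this step, so
   the power crosses the whole gap. *)
Definition stable_approx n : thompson R :=
  (bumps n n.*2 ^+ (2 ^ (n.+2 * n.*2.+1 + 4)))%g.

Lemma bump_id n i (t : R) : t <= 1 - mark n i \/ 1 - mark n i.+1 <= t ->
  bump n i t = t.
Proof.
have := markS_le n i; have := mark_gt0 n i.+1 => ? ? tI.
by apply: bump_fun_out; lra.
Qed.

Lemma bump_ge n i (t : R) : t <= bump n i t.
Proof. by rewrite /= /bump_fun lerDl le_max lexx. Qed.

(** The displacement is a minimum of three terms. The constant 1/16 comes from the right end, where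
    half the distance to the end point is at least [mark n i.+1 / 16]. *)
Lemma bump_push n i (t : R) :
  1 - 7 / 8 * mark n i <= t <= 1 - 9 / 8 * mark n i.+1 ->
  t + mark n i.+1 / 16 <= bump n i t.
Proof.
have := markS_le n i; have := mark_gt0 n i.+1.
rewrite /= /bump_fun => ? ? tI.
by rewrite lerD2l !le_max !le_min; apply/orP; right; lra.
Qed.

Lemma bumps_on n m i (t : R) : 1 - mark n i <= t <= 1 - mark n i.+1 ->
  bumps n m t = if (i < m)%N then bump n i t else t.
Proof.
move=> tI; elim: m => [|m IH] //=.
rewrite -[LHS]/(bump n m (bumps n m t)) IH ltnS.
have [im|mi|->] := ltngtP i m.
- apply: bump_id; left.
  (* [bump n i] fixes the right end of its interval, so by monotonicity it does not push [t] past
     it. *)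
  apply: le_trans (_ : 1 - mark n i.+1 <= _).
    rewrite -[X in _ <= X](@bump_id n i); last by right.
    by rewrite thompson_mono; lra.
  by rewrite lerD2l lerN2 mark_anti.
- apply: bump_id; right; have := @mark_anti n m.+1 i mi; lra.
- by [].
Qed.

Lemma bumps_id n m (t : R) : t <= 1 - mark n 0 -> bumps n m t = t.
Proof.
move=> t0; elim: m => [|m IH] //=.
rewrite -[LHS]/(bump n m (bumps n m t)) IH bump_id//; left.
by apply: le_trans t0 _; rewrite lerD2l lerN2 mark_anti.
Qed.

Lemma fix_expg (f : thompson R) (t : R) k : f t = t -> (f ^+ k)%g t = t.
Proof. by move=> ft; elim: k => // k IH; rewrite expgS thompsonM IH. Qed.

Lemma expg_ge (f : thompson R) (c v : R) : f v = v ->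
  (forall t, c <= t <= v -> t <= f t) ->
  forall k t, c <= t <= v -> t <= (f ^+ k)%g t <= v.
Proof.
move=> fv fge k t tI; elim: k => [|k IH]; first by rewrite thompson_1E; lra.
rewrite expgS thompsonM; have := fge ((f ^+ k)%g t).
by have := thompson_mono f ((f ^+ k)%g t) v; rewrite fv; lra.
Qed.

(** Each application gains at least [e] until [d] is passed; after that the iterates never fall
    back. *)
Lemma expg_push (f : thompson R) (c d v e : R) : f v = v ->
  (forall t, c <= t <= v -> t <= f t) ->
  (forall t, c <= t <= d -> t + e <= f t) ->
  forall k t, c <= t <= v -> d <= (f ^+ k)%g t \/ t + k%:R * e <= (f ^+ k)%g t.
Proof.
move=> fv fge fpush k t tI.
elim: k => [|k IH]; first by right; rewrite mul0r addr0.
have kI := expg_ge fv fge k tI.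
rewrite expgS thompsonM; have := fge ((f ^+ k)%g t).
case: IH => [IH|IH] ft; first by left; lra.
have [kd|dk] := leP ((f ^+ k)%g t) d; last by left; lra.
by right; have := fpush ((f ^+ k)%g t); rewrite -natr1; lra.
Qed.

Lemma stable_approx_id n (t : R) : t <= 1 - mark n 0 -> stable_approx n t = t.
Proof. by move=> t0; apply: fix_expg; exact: bumps_id. Qed.

Section Interval.
Variables n i : nat.
Hypothesis i_lt : (i < n.*2)%N.

Let u := 1 - mark n i.
Let v := 1 - mark n i.+1.
Let g := stable_approx n.

Let bumpsE t : u <= t <= v -> bumps n n.*2 t = bump n i t.
Proof. by move=> tI; rewrite (@bumps_on n _ i) ?i_lt. Qed.

Let uv : u <= v.
Proof. by have := markS_le n i; have := mark_gt0 n i.+1; rewrite /u /v; lra. Qed.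

Let bumps_v : bumps n n.*2 v = v.
Proof. by rewrite bumpsE ?uv ?lexx// bump_id//; right. Qed.

Let bumps_ge t : u <= t <= v -> t <= bumps n n.*2 t.
Proof. by move=> tI; rewrite bumpsE// bump_ge. Qed.

Lemma stable_approx_fix : g u = u /\ g v = v.
Proof.
split; apply: fix_expg => //.
by rewrite bumpsE ?uv ?lexx// bump_id//; left.
Qed.

Lemma stable_approx_ge t : u <= t <= v -> t <= g t.
Proof.
by move=> tI; have /andP[] := expg_ge bumps_v bumps_ge (2 ^ (n.+2 * n.*2.+1 + 4)) tI.
Qed.

Lemma stable_approx_push t : 1 - 7 / 8 * mark n i <= t <= v ->
  1 - 9 / 8 * mark n i.+1 <= g t.
Proof.
move=> tI; have m4 := markS_le n i; have m0 := mark_gt0 n i.+1.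
have [||s sI||] := @expg_push (bumps n n.*2) (1 - 7 / 8 * mark n i)
  (1 - 9 / 8 * mark n i.+1) v (mark n i.+1 / 16) _ _ _
  (2 ^ (n.+2 * n.*2.+1 + 4))%N t tI => //.
- by move=> s sI; apply: bumps_ge; rewrite /u; lra.
- by rewrite bumpsE ?bump_push//; rewrite /u /v; lra.
apply: le_trans.
(* The total gain would be at least 1, more than the gap is long, so the target is reached in either
   case. *)
have : 1 <= (2 ^ (n.+2 * n.*2.+1 + 4))%:R * (mark n i.+1 / 16) :> R.
  rewrite natrX exprD.
  have -> : 2 ^+ (n.+2 * n.*2.+1) * 2 ^+ 4 * (mark n i.+1 / 16)
    = 2 ^+ (n.+2 * n.*2.+1) * mark n i.+1 :> R by field.
  rewrite /mark ler_pdivlMr ?exprn_gt0// mul1r ler_eXn2l ?ltr1n//.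
  by rewrite leq_mul.
have : mark n i <= 1 by exact: inv_pow2_le1.
by move: tI; rewrite /v; lra.
Qed.

(** The ping-pong sets are described through [1 - t], the coordinate in which germs at 1 are
    scalings. *)
Definition near_mark n i (t : R) : Prop :=
  7 / 8 * mark n i <= 1 - t <= 9 / 8 * mark n i.

Definition between_marks n i (t : R) : Prop :=
  9 / 8 * mark n i.+1 < 1 - t < 7 / 8 * mark n i.

(** Positive powers push the gap towards 1, to the mark [i.+1]; negative powers push it away from 1,
    to the mark [i]. The marked points themselves are fixed. *)
Lemma between_to_near (b : bool) k t : between_marks n i t ->
  let y := ((if b then g else g^-1) ^+ k.+1)%g t in
  near_mark n i y \/ near_mark n i.+1 y.
Proof.
have m4 := markS_le n i; have m0 := mark_gt0 n i.+1.
have [gu gv] := stable_approx_fix.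
rewrite /between_marks /near_mark => tI; case: b => /=.
  right; rewrite expgSr thompsonM.
  have gt : 1 - 9 / 8 * mark n i.+1 <= g t.
    by apply: stable_approx_push; rewrite /v; lra.
  have gtv : g t <= v by rewrite -gv thompson_mono /v; lra.
  have gtI : u <= g t <= v by rewrite gtv andbT /u; lra.
  by have := expg_ge gv stable_approx_ge k gtI; rewrite /v; lra.
left.
suff : u <= (g^-1 ^+ k.+1)%g t <= 1 - 7 / 8 * mark n i by rewrite /u; lra.
elim: k => [|k IH].
  rewrite expg1; apply/andP; split.
    by rewrite -(thompson_mono g) thompsonVK gu /u; lra.
  (* Otherwise [g] would carry [g^-1 t] beyond the gap, whereas it carries it to [t]. *)
  rewrite leNgt; apply/negP => /ltW ty.
  have := stable_approx_push (t := g^-1%g t).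
  rewrite thompsonVK => H.
  have : g^-1%g t <= v by rewrite -(thompson_mono g) thompsonVK gv /v; lra.
  by move=> tv; have := H _; rewrite ty tv => /(_ isT); lra.
rewrite expgS thompsonM; move: IH; set z := (g^-1 ^+ k.+1)%g t => zI.
have uz : u <= g^-1%g z by rewrite -(thompson_mono g) thompsonVK gu; lra.
have zz : g^-1%g z <= z.
  have vz : g^-1%g z <= v by rewrite -(thompson_mono g) thompsonVK gv /v; lra.
  by have := @stable_approx_ge (g^-1%g z); rewrite uz vz thompsonVK; apply.
by rewrite uz/=; lra.
Qed.

End Interval.

(** One [n] controls both the exponent, which stays below the ratio of marks, and the interval,
    which contains all marked points of level [n] since [mark n 0 = 2^-(n+2)]. *)
Definition germ n (f : thompson R) (k : int) : Prop :=
  (absz k <= n)%N /\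
  forall t : R, 1 - (2 ^+ n)^-1 <= t <= 1 -> f t = 1 - 2 ^ k * (1 - t).

Lemma pow2_bounds n (k : int) : (absz k <= n)%N -> k != 0 ->
  2 <= (2 : R) ^ k <= 2 ^+ n \/
  (2 : R) ^ k <= 1 / 2 /\ 1 <= (2 : R) ^+ n * 2 ^ k.
Proof.
move=> kn k0; have [kpos|kneg] := ltP 0 k.
  left; rewrite -[2 in X in X && _]expr1z -[2 ^+ n]/(2 ^ n%:Z).
  by rewrite !ler_eXz2l ?ltr1n//; lia.
right; split.
  rewrite mul1r -exprN1 ler_eXz2l ?ltr1n//; lia.
rewrite -[2 ^+ n]/(2 ^ n%:Z) -expfzDr ?pnatr_eq0//.
by rewrite -[1 in X in X <= _](expr0z 2) ler_eXz2l ?ltr1n//; lia.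
Qed.

(** A factor at least 2, or at most 1/2, leaves the window from 7/8 to 9/8; a factor between 2^-n
    and 2^n does not reach the window of a neighbouring mark. *)
Lemma near_to_between n i (f : thompson R) (k : int) t : germ n f k -> k != 0 ->
  near_mark n i.+1 t -> between_marks n i (f t) \/ between_marks n i.+1 (f t).
Proof.
move=> [kn fE] k0; rewrite /near_mark /between_marks => tI.
have W1 := pow2_ge1 n.
have m0 := mark_gt0 n i.+1; have := markS n i; have := markS n i.+1.
have m2 := mark_gt0 n i.+2.
have mW : 4 * mark n i.+1 <= (2 ^+ n)^-1.
  by have := mark_anti n (leq0n i.+1); rewrite -mark0_lt; lra.
have -> : f t = 1 - 2 ^ k * (1 - t) by apply: fE; lra.
move: tI mW => /=; set W := 2 ^+ n in W1 *; set s := 1 - t => sI _.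
have X0 : 0 < 2 ^ k :> R by exact: pow2_gt0.
move: (pow2_bounds kn k0) X0; rewrite -/W; set X := 2 ^ k => XI X0 E1 E2.
rewrite opprB addrCA subrr addr0 E2.
case: XI => [XI|[X2 WX]]; [left|right]; apply/andP; split.
- nra.
- nra.
- nra.
- nra.
Qed.

Lemma germ_near (f : thompson R) : exists k, \forall n \near \oo, germ n f k.
Proof.
have [s [_ sA]] := thompson_dyadic_affine (thompsonP f).
have [a pa] := left_piece s (@ltr01 R) (lexx 1).
have [k kE] := sA _ _ pa; have [a0 a1 _ _] := pa; exists k.
have f1 := thompson1 (thompsonP f).
have a1' : 0 < 1 - a by lra.
near=> n; split; first by near: n; exact: nbhs_infty_ge.
move=> t tI.
have na : (2 ^+ n)^-1 <= 1 - a.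
  apply: ltW; rewrite -div1r; near: n.
  exact: (near_infty_natSinv_expn_lt (PosNum a1')).
rewrite kE ?in_itv/=; last lra.
have : f 1 = f a + 2 ^ k * (1 - a) by apply: kE; rewrite in_itv/=; lra.
by rewrite f1; lra.
Unshelve. all: by end_near.
Qed.

(** Used contrapositively: an element outside [H_lt1] has a nonzero exponent, as [near_to_between]
    requires. *)
Lemma germ0_H n (f : thompson R) : germ n f 0 -> H_lt1 f.
Proof.
move=> [_ fE]; rewrite /H_lt1/= => /(_ (ball (1 : R) (2 ^+ n)^-1)).
case; first by apply: nbhsx_ballx; exact: inv_pow2_gt0.
move=> t [[/=]]; rewrite in_itv/= => tI ft.
rewrite /ball/= => /ltr_normlP[_ tb]; apply: ft.
by rewrite fE ?expr0z; lra.
Qed.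

Lemma H_lt1_fix (f : thompson R) : H_lt1 f ->
  exists2 e : R, 0 < e & forall t, 1 - e <= t -> f t = t.
Proof.
rewrite /H_lt1/= => /existsNP[B] /not_implyP[/nbhs_ballP[e /= e0 eB]].
move=> /nonemptyPn BE; exists (e / 2); first lra.
move=> t et; have [t1|t1] := ltP 1 t.
  by rewrite (thompson_out (thompsonP _))// in_itv/=; lra.
have [t0|t0] := ltP t 0.
  by rewrite (thompson_out (thompsonP _))// in_itv/=; lra.
apply: contrapT => ft; have : (supp f `&` B) t; last by rewrite BE.
split; first by split=> //; rewrite in_itv/=; lra.
by apply: eB; rewrite /ball/= ger0_norm; lra.
Qed.

(** For large [n] the point [1 - mark n 0] is fixed by both maps; to its left [stable_approx n] is
    the identity, to its right [h] is. *)
Lemma stable_approx_commute (h : thompson R) : H_lt1 h ->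
  \forall n \near \oo, commute (stable_approx n) h.
Proof.
move=> /H_lt1_fix[e e0 he]; near=> n.
have ne : mark n 0 <= e.
  have m0 := mark_gt0 n 0.
  apply: (@le_trans _ _ (1 / 2 ^+ n)); first by rewrite div1r -mark0_lt; lra.
  by apply: ltW; near: n; exact: (near_infty_natSinv_expn_lt (PosNum e0)).
apply: thompson_ext => t; rewrite !thompsonM.
have [tn|nt] := leP t (1 - mark n 0).
  rewrite [in RHS]stable_approx_id// stable_approx_id//.
  by rewrite -(he (1 - mark n 0)) ?thompson_mono//; lra.
rewrite (he t) ?he//; last lra.
apply: le_trans (_ : stable_approx n (1 - mark n 0) <= _).
  by rewrite stable_approx_id//; lra.
by rewrite thompson_mono ltW.
Unshelve. all: by end_near.
Qed.

End PingPong.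

(** * Evaluation of words and the elements they span *)

Section Words.
Variables (X : Type) (G : groupType).
Implicit Types (s : X -> G) (u v w : word X).

Lemma weval_cons s x b w :
  weval s ((x, b) :: w) = ((if b then s x else (s x)^-1) * weval s w)%g.
Proof. by rewrite /weval big_cons. Qed.

Lemma weval_nil s : weval s [::] = 1%g.
Proof. by rewrite /weval big_nil. Qed.

Lemma weval_cat s u v : weval s (u ++ v) = (weval s u * weval s v)%g.
Proof. by rewrite /weval big_cat. Qed.

Lemma weval_winv s w : weval s (winv w) = (weval s w)^-1%g.
Proof.
elim: w => [|[x b] w IH]; first by rewrite weval_nil invg1.
rewrite /winv map_cons rev_cons -cats1 weval_cat -/(winv w) IH !weval_cons.
by rewrite weval_nil mulg1 invgM; case: b; rewrite //= invgK.
Qed.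

Lemma weval_nseq s x b k :
  weval s (nseq k (x, b)) = ((if b then s x else (s x)^-1) ^+ k)%g.
Proof.
by elim: k => [|k IH]; rewrite ?weval_nil// /= weval_cons IH expgS.
Qed.

Lemma weval_map (Y : Type) s (h : Y -> X) (w : word Y) :
  weval s [seq (h l.1, l.2) | l <- w] = weval (s \o h) w.
Proof. by rewrite /weval big_map. Qed.

Lemma eq_weval s s' w : s =1 s' -> weval s w = weval s' w.
Proof. by move=> ss'; apply: eq_bigr => l _; rewrite ss'. Qed.

End Words.

Section Span.
Variables (G : groupType) (m : nat) (s : m.-tuple G).

Definition spanned (x : G) : Prop := exists w : word 'I_m, weval (tnth s) w = x.

Lemma spanned_gen i : spanned (tnth s i).
Proof. by exists [:: (i, true)]; rewrite weval_cons weval_nil mulg1. Qed.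

Lemma spannedM x y : spanned x -> spanned y -> spanned (x * y)%g.
Proof. by move=> [u <-] [v <-]; exists (u ++ v); rewrite weval_cat. Qed.

Lemma spannedV x : spanned x -> spanned x^-1%g.
Proof. by move=> [u <-]; exists (winv u); rewrite weval_winv. Qed.

Lemma spanned1 : spanned 1%g.
Proof. by exists [::]; rewrite weval_nil. Qed.

End Span.

Lemma weval_pgen (X : choiceType) (P : set (word X)) (w : word X) :
  weval (pgen P) w = pclass P w.
Proof.
elim: w => [|[x b] w IH]; first by rewrite weval_nil.
rewrite weval_cons IH -[(x, b) :: w]cat1s -pmulE; congr (_ * _)%g.
by case: b => //; exact: pinvE.
Qed.

(** * Reduced forms in the centralized HNN-extension *)

Section HNNNormalForm.
Variables (F : groupType) (H : set F).
Let T : centralized_hnn H := hnn_stable H.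

Lemma hnn_relator_eval (r : word (option F)) : hnn_relators H r ->
  weval (pgen (hnn_relators H)) r = 1%g.
Proof. by move=> Hr; rewrite weval_pgen; apply/pclassP; exact: pres_relator. Qed.

Lemma hnn_baseM a b : hnn_base H (a * b)%g = (hnn_base H a * hnn_base H b)%g.
Proof.
have := @hnn_relator_eval [:: (Some a, true); (Some b, true); (Some (a * b)%g, false)].
rewrite !weval_cons weval_nil mulg1 mulgA => E; apply/esym/divg1_eq/E.
by left; exists (a, b).
Qed.

Lemma hnn_base1 : hnn_base H 1%g = 1%g.
Proof. by apply: (mulgI (hnn_base H 1%g)); rewrite -hnn_baseM !mulg1. Qed.

Lemma hnn_baseV a : hnn_base H a^-1%g = (hnn_base H a)^-1%g.
Proof.
by apply: (mulgI (hnn_base H a)); rewrite -hnn_baseM !mulgV hnn_base1.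
Qed.

Lemma hnn_stable_commute h : H h -> commute T (hnn_base H h).
Proof.
move=> Hh; have := @hnn_relator_eval
  [:: (None, true); (Some h, true); (None, false); (Some h, false)].
rewrite !weval_cons weval_nil mulg1 !mulgA => E.
have /divg1_eq := E (or_intror (ex_intro2 _ _ h Hh erefl)).
by move=> /(congr1 ( *%g^~ T)); rewrite mulgVK.
Qed.

(* The syllable [(b, k, f)] stands for [t^(k+1) f] or [t^-(k+1) f]. *)
Definition syllables (G : groupType) (phi : F -> G) (t : G)
    (l : seq (bool * nat * F)) : G :=
  foldr (fun x y =>
    (if x.1.1 then t else t^-1) ^+ x.1.2.+1 * (phi x.2 * y))%g 1%g l.

Lemma syllables_cons (G : groupType) (phi : F -> G) (t : G) b k f l :
  syllables phi t ((b, k, f) :: l) =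
  ((if b then t else t^-1) ^+ k.+1 * (phi f * syllables phi t l))%g.
Proof. by []. Qed.

(** Elements of [H] commute with the stable letter, so they are excluded between any two powers, of
    equal or opposite sign. The last element is free, as no power follows it. *)
Fixpoint britton_reduced (l : seq (bool * nat * F)) : Prop :=
  if l is x :: l' then (l' <> [::] -> ~ H x.2) /\ britton_reduced l' else True.

Definition syllables_word (f0 : F) (l : seq (bool * nat * F)) :
    word (option F) :=
  (Some f0, true) ::
  flatten [seq nseq x.1.2.+1 (None, x.1.1) ++ [:: (Some x.2, true)] | x <- l].

Lemma weval_syllables_word (G : groupType) (s : option F -> G) f0 l :
  weval s (syllables_word f0 l) =
  (s (Some f0) * syllables (s \o Some) (s None) l)%g.
Proof.
rewrite /syllables_word weval_cons; congr (_ * _)%g.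
elim: l => [|[[b k] f] l IH] /=; first by rewrite weval_nil.
by rewrite weval_cons -catA weval_cat weval_nseq weval_cons IH expgS !mulgA.
Qed.

(** Letters are prepended one at a time. A base letter is absorbed by [f0]. A stable letter opens a
    new syllable if [f0] is not in [H]; otherwise it moves past [f0] and merges or cancels with the
    first power. *)
Lemma hnn_normal_form (w : word (option F)) : exists f0 l,
  britton_reduced l /\ weval (pgen (hnn_relators H)) w =
  (hnn_base H f0 * syllables (hnn_base H) T l)%g.
Proof.
elim: w => [|[[a|] e] w [f0 [l [lred IH]]]].
- by exists 1%g, [::]; rewrite weval_nil hnn_base1 mulg1.
- exists ((if e then a else a^-1) * f0)%g, l; split=> //.
  rewrite weval_cons IH mulgA hnn_baseM; congr (_ * _ * _)%g.
  by case: e; rewrite // hnn_baseV.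
rewrite weval_cons IH -/(hnn_stable H) -/T.
set Te := (if e then T else _).
have [Hf0|Hf0] := pselect (H f0); last first.
  exists 1%g, ((e, 0%N, f0) :: l); split=> //=.
  by rewrite hnn_base1 mul1g expg1.
case: l lred {IH} => [|[[b k] f] l] /= => [_|[lf lred]].
  exists 1%g, [:: (e, 0%N, f0)]; split=> //=.
  by rewrite hnn_base1 mul1g expg1.
have TeC : (Te * hnn_base H f0)%g = (hnn_base H f0 * Te)%g.
  rewrite /Te; case: (e); first exact: hnn_stable_commute.
  by apply/commute_sym/commuteV/commute_sym/hnn_stable_commute.
rewrite mulgA TeC -mulgA.
have [eb|eb] := eqVneq e b.
  exists f0, ((b, k.+1, f) :: l); split=> //=.
  by rewrite [in RHS]expgS -eb -/Te !mulgA.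
have Teb : (Te * (if b then T else T^-1))%g = 1%g.
  by move: eb; rewrite /Te; case: (e); case: (b) => // _; rewrite ?mulgV ?mulVg.
rewrite expgS -[X in (_ * (Te * X))%g]mulgA [(Te * _)%g]mulgA Teb mul1g.
(* If the first power had exponent one, its syllable disappears and its base element joins the head,
   on which reducedness puts no condition. *)
case: k => [|k].
  exists (f0 * f)%g, l; split=> //.
  by rewrite expg0 mul1g hnn_baseM mulgA.
by exists f0, ((b, k, f) :: l).
Qed.

End HNNNormalForm.

(** * Convergence of the marked groups *)

Section Limit.
Variable R : realType.
Local Notation F := (thompson R).
Local Notation H := (@H_lt1 R).

Definition approx_eval n (o : option F) : F := odflt (stable_approx R n) o.

(** A derivation uses finitely many relators: those of the multiplication table hold for every [n],
    and each commutation with an element of [H_lt1] holds eventually. *)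
Lemma pres_eq_near (u v : word (option F)) : pres_eq (hnn_relators H) u v ->
  \forall n \near \oo, weval (approx_eval n) u = weval (approx_eval n) v.
Proof.
elim=> {u v} [u|u v _ IH|u v w _ IHu _ IHv|u u' v v' _ IHu _ IHv|x b|r].
- by near=> n.
- by near=> n; apply/esym; near: n.
- by near=> n; transitivity (weval (approx_eval n) v); near: n.
- by near=> n; rewrite !weval_cat; congr (_ * _)%g; near: n.
- near=> n; rewrite !weval_cons weval_nil mulg1.
  by case: b; rewrite /= ?mulgV ?mulVg.
case=> [[[a b] _ <-]|[h Hh <-]].
  by near=> n; rewrite !weval_cons weval_nil mulg1/= mulgA mulgV.
near=> n; rewrite !weval_cons weval_nil mulg1 /= !mulgA.
have -> : (stable_approx R n * h = h * stable_approx R n)%g.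
  by near: n; exact: stable_approx_commute.
by rewrite mulgK mulgV.
Unshelve. all: by end_near.
Qed.

(** The orbit starts in the gap [n] and each syllable changes the index by at most one. With at most
    [n] syllables it stays among the [n.*2] gaps on which bumps act. *)
Lemma syllables_ping_pong n (l : seq (bool * nat * F)) (x0 : bool * nat * F) t :
  britton_reduced H l -> l <> [::] -> (size l <= n)%N ->
  {in l, forall x, exists k, germ n x.2 k} ->
  between_marks n n ((last x0 l).2 t) ->
  exists i, [/\ (n.+1 - size l <= i)%N, (i <= n + size l)%N &
    near_mark n i (syllables id (stable_approx R n) l t)].
Proof.
elim: l x0 => // -[[b k] f] l IH x0 [lf lred] _ ln lg.
have nn : (n < n.*2)%N by rewrite -addnn; move: ln => /=; lia.
case: l IH lf lred ln lg => [_ _ _ _ _ tB|y l IH lf lred ln lg tB].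
  rewrite syllables_cons mulg1 thompsonM.
  by case: (between_to_near nn b k tB) => ?; [exists n|exists n.+1]; split=> //=; lia.
rewrite syllables_cons !thompsonM.
have [|||i [il ir iA]] := IH (b, k, f) lred _ _ _ tB => //.
- exact: ltnW.
- by move=> z zl; apply: lg; rewrite inE zl orbT.
have [e fe] := lg (b, k, f) (mem_head _ _).
have e0 : e != 0.
  by apply/eqP => e0; rewrite e0 in fe; apply: (lf _ (germ0_H fe)).
case: i il ir iA => [|i] il ir iA; first by move: il ln => /=; lia.
have : exists j, [/\ (i <= j <= i.+1)%N & between_marks n j
    (f (syllables id (stable_approx R n) (y :: l) t))].
  by case: (near_to_between fe e0 iA) => ?; [exists i|exists i.+1];
    split=> //; rewrite ?leqnn ?leqnSn.
move=> [j [ij jB]].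
move: il ir ln => /= il ir ln; have jn : (j < n.*2)%N by rewrite -addnn; lia.
case: (between_to_near jn b k jB) => ?; [exists j|exists j.+1]; split=> //; lia.
Qed.

(** Marks are powers of 2, so the quotient by [mark n i] is 3/4 times a power of 2: at most 3/4 or
    at least 3/2, hence outside the window. *)
Lemma pow2_scale_mark n i j (k : int) :
  ~ (7 / 8 * mark R n i <= 2 ^ k * (3 / 4 * mark R n j) <= 9 / 8 * mark R n i).
Proof.
pose z : int := k - (n.+2 * j.+1)%:Z + (n.+2 * i.+1)%:Z.
have zE : 2 ^ k * mark R n j = 2 ^ z * mark R n i.
  by rewrite /mark !exprnN -!expfzDr ?pnatr_eq0//; congr (_ ^ _); rewrite /z; lia.
have m0 := mark_gt0 R n i; rewrite mulrCA zE => zI.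
have [z0|z0] := leP z 0.
  have : (2 : R) ^ z <= 2 ^ 0 by rewrite ler_eXz2l ?ltr1n.
  by rewrite expr0z; nra.
have : (2 : R) ^ 1 <= 2 ^ z by rewrite ler_eXz2l ?ltr1n//; lia.
by rewrite expr1z; nra.
Qed.

Lemma syllables_neq1_near (f0 : F) (l : seq (bool * nat * F)) :
  britton_reduced H l -> l <> [::] ->
  \forall n \near \oo, (f0 * syllables id (stable_approx R n) l)%g <> 1%g.
Proof.
move=> lred l0; pose fm := (last (true, 0%N, f0) l).2.
(* If the word were trivial, its syllables would act as [f0^-1]. Applied to [fm^-1 y], they would
   merely scale the distance of [y] to 1 by 2^k0. *)
have [k0 k0E] := germ_near (f0^-1 * fm^-1)%g.
have lE : \forall n \near \oo, {in l, forall x, exists k, germ n x.2 k}.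
  elim: (l) => [|x l' IH]; first by near=> n.
  have [k kE] := germ_near x.2.
  near=> n; move=> y; rewrite inE => /orP[/eqP->|].
    by exists k; near: n.
  by move: y; near: n.
near=> n => E.
have ln : (size l <= n)%N by near: n; exact: nbhs_infty_ge.
have m0 := mark_gt0 R n n; have m4 := markS_le R n n.
(* The factor 3/4 puts [y] in the gap [n] and, by [pow2_scale_mark], keeps all its scalings by
   powers of 2 away from the marks. *)
pose y : R := 1 - 3 / 4 * mark R n n.
have [||i [_ _]] := @syllables_ping_pong n l (true, 0%N, f0) (fm^-1%g y) lred l0 ln.
- by near: n.
- by rewrite -/fm thompsonVK /between_marks /y; have := mark_gt0 R n n.+1; lra.
have -> : syllables id (stable_approx R n) l = f0^-1%g.
  by apply/esym/mulg1_eq.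
rewrite -thompsonM.
have [_ ->] : germ n (f0^-1 * fm^-1)%g k0 by near: n.
  rewrite /near_mark opprB addrCA subrr addr0 /y opprB addrCA subrr addr0.
  exact: pow2_scale_mark.
rewrite /y.
have := mark_anti R n (leq0n n); have := mark0_lt R n; lra.
Unshelve. all: by end_near.
Qed.

(** A trivial word is handled by its derivation, a nontrivial one by its reduced form: with
    syllables, ping-pong applies; without, [w] eventually evaluates to [f0], which is not 1 because
    its image in the extension is not. *)
Lemma eval_near (w : word (option F)) : \forall n \near \oo,
  weval (approx_eval n) w = 1%g <-> weval (pgen (hnn_relators H)) w = 1%g.
Proof.
have [w1|w1] := pselect (weval (pgen (hnn_relators H)) w = 1%g).
  near=> n; split=> // _; rewrite -[RHS](weval_nil (approx_eval n)); near: n.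
  by apply: pres_eq_near; apply/pclassP; rewrite -weval_pgen.
have [f0 [l [lred wE]]] := hnn_normal_form H w.
have nE : \forall n \near \oo, weval (approx_eval n) w =
    (f0 * syllables id (stable_approx R n) l)%g.
  near=> n.
  rewrite -[RHS](weval_syllables_word (approx_eval n)); near: n.
  by apply/pres_eq_near/pclassP; rewrite -!weval_pgen wE weval_syllables_word.
case: l lred wE nE => [|x l] lred wE nE; near=> n; split=> // wn; exfalso.
  apply: w1; rewrite wE mulg1 -(hnn_base1 H); congr hnn_base.
  by rewrite -wn -[LHS]mulg1; apply/esym; near: n.
have : (f0 * syllables id (stable_approx R n) (x :: l))%g = 1%g.
  by rewrite -wn; apply/esym; near: n.
by near: n; exact: syllables_neq1_near.
Unshelve. all: by end_near.
Qed.

(** Translates words in the three marked letters into the alphabet of the presentation, to which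
    [eval_near] applies. *)
Lemma letters_eval (G : groupType) (s : option F -> G) (w : word 'I_3) :
  weval (tnth [tuple s None; s (Some (thompson_x0 R)); s (Some (thompson_x1 R))]) w =
  weval s [seq (tnth [tuple None; Some (thompson_x0 R); Some (thompson_x1 R)] l.1,
                l.2) | l <- w].
Proof.
rewrite weval_map; apply: eq_weval => i /=.
by case: i => [[|[|[|?]]] ilt] //; rewrite !(tnth_nth (s None)) !(tnth_nth None).
Qed.

Lemma thompson_generates n :
  generates [tuple stable_approx R n; thompson_x0 R; thompson_x1 R].
Proof.
move=> f; apply: (@thompson_generated R (spanned _)).
- exact: (spanned_gen _ (@Ordinal 3 1 isT)).
- exact: (spanned_gen _ (@Ordinal 3 2 isT)).
- by move=> a b; exact: spannedM.
- by move=> a; exact: spannedV.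
Qed.

Lemma hnn_generates : generates [tuple hnn_stable H;
  hnn_base H (thompson_x0 R); hnn_base H (thompson_x1 R)].
Proof.
set S := [tuple _; _; _].
have base f : spanned S (hnn_base H f).
  apply: (@thompson_generated R (fun f => spanned S (hnn_base H f))).
  - exact: (spanned_gen S (@Ordinal 3 1 isT)).
  - exact: (spanned_gen S (@Ordinal 3 2 isT)).
  - by move=> a b; rewrite hnn_baseM; exact: spannedM.
  - by move=> a; rewrite hnn_baseV; exact: spannedV.
move=> x; rewrite -(pclass_repr x) -weval_pgen.
elim: (repr x) => [|[c b] w IH]; first by rewrite weval_nil; exact: spanned1.
rewrite weval_cons; apply: spannedM => //.
have So : spanned S (pgen (hnn_relators H) c).
  by case: c => [a|]; [exact: base|exact: (spanned_gen S ord0)].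
by case: b => //; exact: spannedV.
Qed.

Lemma same_relations_near r : \forall n \near \oo,
  same_relations r (MarkedGroup (thompson_generates n)) (MarkedGroup hnn_generates).
Proof.
(* Words of length at most [r] form a finite type, so the eventual statements for single words hold
   simultaneously. *)
have : \forall n \near \oo, forall w : r.-bseq ('I_3 * bool),
    is_relation (MarkedGroup (thompson_generates n)) w <->
    is_relation (MarkedGroup hnn_generates) w.
  apply: filter_forall => w; rewrite /is_relation /=.
  near=> n; rewrite (@letters_eval _ (pgen (hnn_relators H))).
  rewrite (@letters_eval _ (approx_eval n)).
  by near: n; exact: eval_near.
apply: filterS => n H1 w wr; exact: (H1 (Bseq wr)).
Unshelve. all: by end_near.
Qed.

Lemma marked_dist_ge0 m (G G' : markedGroup m) : 0 <= marked_dist R G G'.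
Proof.
apply: lb_le_inf; last by move=> _ [r _ <-]; exact: expR_ge0.
(* The infimum is over a nonempty set: at radius 0 only the empty word is tested. *)
exists (expR (- 0%:R)); exists 0%N => //= w.
by rewrite leqn0 => /nilP ->; split=> _; rewrite /is_relation weval_nil.
Qed.

Lemma marked_dist_le m r (G G' : markedGroup m) : same_relations r G G' ->
  marked_dist R G G' <= expR (- r%:R).
Proof.
move=> GG'; apply: ge_inf; last by exists r.
by exists 0 => _ [k _ <-]; exact: expR_ge0.
Qed.

End Limit.

Theorem theorem2p10 (R : realType) :
  exists (g_ : nat -> thompson R)
    (genF : forall n,
       generates [tuple g_ n; thompson_x0 R; thompson_x1 R])
    (genHNN :
       generates [tuple hnn_stable (@H_lt1 R);
                        hnn_base (@H_lt1 R) (thompson_x0 R);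
                        hnn_base (@H_lt1 R) (thompson_x1 R)]),
  marked_dist R (MarkedGroup (genF n)) (MarkedGroup genHNN)
    @[n --> \oo] --> 0.
Proof.
exists (stable_approx R), (@thompson_generates R), (@hnn_generates R).
apply/cvgr0Pnorm_le => e e0.
near=> n; rewrite ger0_norm ?marked_dist_ge0//.
(* With [r] an integer above [e^-1], the inequality [1 + r <= expR r] gives [expR (- r) <= e]. *)
apply: (@le_trans _ _ (expR (- (Num.bound e^-1)%:R))).
  by apply: marked_dist_le; near: n; exact: same_relations_near.
rewrite expRN -[leRHS]invrK lef_pV2 ?posrE ?expR_gt0 ?invr_gt0//.
apply: le_trans (_ : 1 + (Num.bound e^-1)%:R <= _); last exact: expR_ge1Dx.
have : e^-1 < (Num.bound e^-1)%:R.
  by apply: archi_boundP; rewrite invr_ge0 ltW.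
by lra.
Unshelve. all: by end_near.
Qed.
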